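(* Let $N\ge0$, $\vec{\mathbf a}_N=(a(0),\dots,a(N))\in\mathbb C^{N+1}$, $P_1>0$, let $v,u$ be given bounded spectral densities, and $$D_v^u=\left\{f: v(\lambda)\le f(\lambda)\le u(\lambda),\ \frac1{2\pi}\int_{-\pi}^\pi f(\lambda)d\lambda\le P_1\right\}.$$ Let $f_0\in D_v^u$, let $f_0^{-1}$ be integrable, put $C_N^0(e^{i\lambda})=\sum_{j=0}^N((B_N^0)^{-1}\vec{\mathbf a}_N)_je^{ij\lambda}$, and let the function $$h(f_0)=\sum_{j=0}^Na(j)e^{ij\lambda}-C_N^0(e^{i\lambda})f_0^{-1}(\lambda)$$ be bounded. Suppose that for some constant $\alpha_1>0$ $$f_0(\lambda)=\max\left\{v(\lambda),\min\left\{u(\lambda),\alpha_1\left|C_N^0(e^{i\lambda})\right|\right\}\right\}$$ and that $f_0$ determines a solution to the optimization problem $$\max_{f\in D_v^u}\langle B_N^{-1}\vec{\mathbf a}_N,\vec{\mathbf a}_N\rangle=\langle(B_N^0)^{-1}\vec{\mathbf a}_N,\vec{\mathbf a}_N\rangle .$$ Then $f_0$ is the least favourable spectral density in $D_v^u$ for the optimal linear estimate of $A_N\xi=\sum_{j=0}^Na(j)\xi(j)$ based on observations of $\xi(j)$ at $j\in\mathbb Z\setminus\{0,1,\dots,N\}$, and $h^0=h(f_0)$ is the minimax-robust spectral characteristic of the optimal linear estimate of $A_N\xi$.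
   Context: $\xi$ is a zero mean wide sense stationary sequence with spectral density $f$: $E\xi(j+k)\overline{\xi(j)}=\frac1{2\pi}\int_{-\pi}^\pi e^{ik\lambda}f(\lambda)d\lambda$. $B_N$ is the $(N+1)\times(N+1)$ matrix with entries $\frac1{2\pi}\int_{-\pi}^\pi f^{-1}(\lambda)e^{-i(k-j)\lambda}d\lambda$, $k,j=0,\dots,N$ (densities $f$ being understood to satisfy the minimality condition $\int f^{-1}d\lambda<\infty$ wherever $B_N^{-1}$ is used), and $B_N^0$ is this matrix for $f_0$. $\langle x,y\rangle=\sum_{k=0}^Nx_k\overline{y_k}$. $L_2^N(f)$ is the closed span of $\{e^{ij\lambda}:j\in\mathbb Z\setminus\{0,\dots,N\}\}$ in $L_2(f)$; for $h\in L_2^N(f)$, $\Delta(h;f)=\frac1{2\pi}\int_{-\pi}^\pi|\sum_{j=0}^Na(j)e^{ij\lambda}-h|^2f\,d\lambda$, and $h(f)$ denotes its minimizer. For a class $D$ of densities, $f_0\in D$ is least favourable if $\Delta(h(f_0);f_0)=\max_{f\in D}\Delta(h(f);f)$; $h^0$ is minimax-robust if $h^0\in H_D=\bigcap_{f\in D}L_2^N(f)$ and $\min_{h\in H_D}\max_{f\in D}\Delta(h;f)=\sup_{f\in D}\Delta(h^0;f)$. *)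

(* Defs.v *)
From HB Require Import structures.
From mathcomp Require Import all_boot all_order all_algebra.
From mathcomp Require Import complex.
From mathcomp Require Import all_classical all_reals all_analysis.

Set Implicit Arguments.
Unset Strict Implicit.
Unset Printing Implicit Defensive.

Import Order.TTheory GRing.Theory Num.Theory.
Import numFieldNormedType.Exports.

Local Open Scope classical_set_scope.
Local Open Scope complex_scope.
Local Open Scope ring_scope.

(* Functions of the frequency are total functions on R of which only the
   restriction to [-pi, pi], up to Lebesgue-null sets, matters: inequalities,
   equalities and boundedness are all required almost everywhere. *)
Definition torus (R : realType) : set R := `[- pi, pi]%classic.
Arguments torus : clear implicits.

Definition ae_torus (R : realType) (P : R -> Prop) : Prop :=
  {ae (@lebesgue_measure R), forall x, torus R x -> P x}.

Definition modulus (R : realType) (z : R[i]) : R := ComplexField.Normc.normc z.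

Definition cmeasurable (R : realType) (h : R -> R[i]) : Prop :=
  measurable_fun (torus R) (fun x => complex.Re (h x)) /\
  measurable_fun (torus R) (fun x => complex.Im (h x)).

Definition cintegral (R : realType) (h : R -> R[i]) : R[i] :=
  (\int[@lebesgue_measure R]_(x in torus R) complex.Re (h x)) +i*
  (\int[@lebesgue_measure R]_(x in torus R) complex.Im (h x)).

Definition ess_bounded (R : realType) (h : R -> R[i]) : Prop :=
  exists M : R, ae_torus (fun x => modulus (h x) <= M).

(* e^{i t} *)
Definition expi (R : realType) (t : R) : R[i] := cos t +i* sin t.

Definition spectral_density (R : realType) (f : R -> R) : Prop :=
  ae_torus (fun x => 0 <= f x) /\
  (@lebesgue_measure R).-integrable (torus R) (EFin \o f).

(* The inverse is taken in \bar R, where 0^-1 = +oo: a density vanishing on a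
   set of positive measure is not minimal.  For a minimal density, the real
   inverse (with 0^-1 = 0) used in B_mx and C_poly below differs from the
   extended one only on a null set. *)
Definition minimal_density (R : realType) (f : R -> R) : Prop :=
  (\int[@lebesgue_measure R]_(x in torus R) (((f x)%:E)^-1) < +oo)%E.

Definition B_mx (R : realType) (N : nat) (f : R -> R) : 'M[R[i]]_N.+1 :=
  \matrix_(k, j) (((2 * pi)^-1)%:C *
    cintegral (fun x => ((f x)^-1)%:C * expi (- ((k%:R - j%:R) * x)))).

Definition inner (R : realType) (N : nat) (x y : 'cV[R[i]]_N.+1) : R[i] :=
  \sum_(k < N.+1) x k 0 * conjc (y k 0).

Definition trig_poly (R : realType) (N : nat) (c : 'cV[R[i]]_N.+1) (x : R) :
    R[i] :=
  \sum_(j < N.+1) c j 0 * expi (j%:R * x).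

Definition C_poly (R : realType) (N : nat) (a : 'cV[R[i]]_N.+1) (f : R -> R) :
    R -> R[i] :=
  trig_poly (invmx (B_mx N f) *m a).

Definition h_char (R : realType) (N : nat) (a : 'cV[R[i]]_N.+1) (f : R -> R) :
    R -> R[i] :=
  fun x => trig_poly a x - C_poly a f x * ((f x)^-1)%:C.

(* The squared seminorm of L_2(f), without the factor 1 / (2 pi). *)
Definition sqnormL2 (R : realType) (f : R -> R) (h : R -> R[i]) : \bar R :=
  (\int[@lebesgue_measure R]_(x in torus R) ((modulus (h x) ^+ 2 * f x)%:E))%E.

Definition observed_poly (R : realType) (N : nat) (p : R -> R[i]) : Prop :=
  exists (s : seq int) (c : int -> R[i]),
    (forall j : int, j \in s -> ~~ (0 <= j <= N%:Z)) /\
    (forall x, p x = \sum_(j <- s) c j * expi (j%:~R * x)).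

Definition L2N (R : realType) (N : nat) (f : R -> R) : set (R -> R[i]) :=
  [set h | cmeasurable h /\ (sqnormL2 f h < +oo)%E /\
    forall eps : R, 0 < eps ->
      exists p, observed_poly N p /\
        (sqnormL2 f (fun x => (h x - p x)%R) < eps%:E)%E].

Definition Delta (R : realType) (N : nat) (a : 'cV[R[i]]_N.+1)
    (h : R -> R[i]) (f : R -> R) : \bar R :=
  (((2 * pi)^-1)%:E * sqnormL2 f (fun x => (trig_poly a x - h x)%R))%E.

(* h is (a representative of) the minimizer h(f) *)
Definition optimal_char (R : realType) (N : nat) (a : 'cV[R[i]]_N.+1)
    (f : R -> R) (h : R -> R[i]) : Prop :=
  L2N N f h /\ forall g, L2N N f g -> (Delta a h f <= Delta a g f)%E.

(* Delta (h(f0); f0) = max_(f in D) Delta (h(f); f).  The value Delta (h(f); f)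
   does not depend on the choice of the minimizer. *)
Definition least_favourable (R : realType) (N : nat) (a : 'cV[R[i]]_N.+1)
    (D : set (R -> R)) (f0 : R -> R) : Prop :=
  D f0 /\ exists h0, optimal_char a f0 h0 /\
    forall f, D f ->
      exists h, optimal_char a f h /\ (Delta a h f <= Delta a h0 f0)%E.

Definition H_class (R : realType) (N : nat) (D : set (R -> R)) :
    set (R -> R[i]) :=
  \bigcap_(f in D) L2N N f.

Definition sup_Delta (R : realType) (N : nat) (a : 'cV[R[i]]_N.+1)
    (D : set (R -> R)) (h : R -> R[i]) : \bar R :=
  ereal_sup [set Delta a h f | f in D].

Definition minimax_robust (R : realType) (N : nat) (a : 'cV[R[i]]_N.+1)
    (D : set (R -> R)) (h0 : R -> R[i]) : Prop :=
  H_class N D h0 /\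
  forall h, H_class N D h -> (sup_Delta a D h0 <= sup_Delta a D h)%E.

Definition D_band (R : realType) (v u : R -> R) (P1 : R) : set (R -> R) :=
  [set f | spectral_density f /\
    ae_torus (fun x => v x <= f x <= u x) /\
    (2 * pi)^-1 * (\int[@lebesgue_measure R]_(x in torus R) f x) <= P1].

(* f0 solves max_(f in D) <B_N^-1 a, a>, the maximum being over the minimal
   densities of D, for which B_N is defined (and invertible).  The order on
   R[i] compares real parts of numbers with equal imaginary parts; both sides
   are real, B_N being Hermitian. *)
Definition solves_extremum (R : realType) (N : nat) (a : 'cV[R[i]]_N.+1)
    (D : set (R -> R)) (f0 : R -> R) : Prop :=
  D f0 /\ minimal_density f0 /\
  forall f, D f -> minimal_density f ->
    inner (invmx (B_mx N f) *m a) a <= inner (invmx (B_mx N f0) *m a) a.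

(* Main.v *)
(* For a minimal density f put C = sum_j (B_N^-1 a)_j e^{ij.}.  The functions of
   L_2(f) with Fourier coefficients a(0), ..., a(N) on {0, ..., N} all have
   squared norm at least 2 pi <B_N^-1 a, a>, and C / f attains it; this makes
   h(f0) optimal for f0.  Differentiating <B_N^-1 a, a> along the segments from
   f0 to the other densities f of the class gives Delta (h(f0); f) <=
   Delta (h(f0); f0), the saddle point inequality behind both conclusions.  The
   function h(f0) is an admissible characteristic for every f of the class since
   it is bounded and its coefficients on {0, ..., N} vanish: its projection on
   the observed exponentials in L_2(d lambda) differs from it by a function all
   of whose Fourier coefficients vanish.  The minimizers h(f) for non-minimal f
   come from the completeness of L_2(f). *)
Require Import Defs.
From HB Require Import structures.
From mathcomp Require Import all_boot all_order all_algebra.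
From mathcomp Require Import complex ring lra.
From mathcomp Require Import all_classical all_reals all_analysis.
From mathcomp Require Import measurable_realfun.
Set Implicit Arguments.
Unset Strict Implicit.
Unset Printing Implicit Defensive.
Import Order.TTheory GRing.Theory Num.Theory.
Import numFieldNormedType.Exports.
Local Open Scope classical_set_scope.
Local Open Scope complex_scope.
Local Open Scope ring_scope.

(** The extremum ranges over minimal densities, but the saddle inequality is needed for every [f] of
    the class. Convexity bridges the gap: (1 - t) f0 + t f dominates (1 - t) f0, so it is minimal
    for t < 1 even if [f] is not. No derivative of <B_N^-1 a, a> is taken and B_N^-1 is never
    expanded in t: the dual bound, tested at the fixed coefficients of [f0], turns optimality into
    an inequality between integrals, and Fatou's lemma carries it to t = 0. The finiteness of the
    norm of C / f0 in L_2(f) comes out of the same passage to the limit. Uniqueness of Fourier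
    coefficients is proved for integrable functions: polynomials in cos and sin with values in
    [0, 1] converge to indicators of rays, so all integrals over rays vanish, and Lebesgue
    differentiation concludes. The bound on [u] makes the L_2(f) norm smaller than a multiple of the
    Lebesgue one, so that approximations found for the weight 1 serve all [f] of the class
    together. *)

#[local] Notation ae_filter R :=
  (ae_filter_ringOfSetsType (@lebesgue_measure R)).

(** * Real integrals over the torus *)

Definition tintegrable (R : realType) (g : R -> R) : Prop :=
  (@lebesgue_measure R).-integrable (torus R) (EFin \o g).

Definition tintegral (R : realType) (g : R -> R) : R :=
  \int[@lebesgue_measure R]_(x in torus R) g x.

Lemma measurable_torus (R : realType) :
  @measurable _ (g_sigma_algebraType R.-ocitv.-measurable) (torus R).
Proof. exact: measurable_itv. Qed.
#[local] Hint Resolve measurable_torus : core.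

Lemma torus_measure (R : realType) :
  @lebesgue_measure R (torus R) = (2 * pi)%:E.
Proof.
rewrite /torus lebesgue_measure_itv /= lte_fin.
have pi0 := pi_gt0 R.
have -> : - pi < pi :> R by lra.
by congr (_%:E); lra.
Qed.

Lemma ae_torusW (R : realType) (P : R -> Prop) :
  (forall x, P x) -> ae_torus P.
Proof. by move=> h; apply: aeW => x _. Qed.

Lemma ae_torusS (R : realType) (P Q : R -> Prop) :
  (forall x, P x -> Q x) -> ae_torus P -> ae_torus Q.
Proof.
by rewrite /ae_torus => h; apply: (@filterS _ _ (ae_filter R)) => x hx Dx;
  apply: h; apply: hx.
Qed.

Lemma ae_torusS2 (R : realType) (P1 P2 Q : R -> Prop) :
  (forall x, P1 x -> P2 x -> Q x) -> ae_torus P1 -> ae_torus P2 -> ae_torus Q.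
Proof.
rewrite /ae_torus => h; apply: (@filterS2 _ _ (ae_filter R)) => x h1 h2 Dx.
by apply: h; [apply: h1|apply: h2].
Qed.

Lemma ae_torusS3 (R : realType) (P1 P2 P3 Q : R -> Prop) :
  (forall x, P1 x -> P2 x -> P3 x -> Q x) ->
  ae_torus P1 -> ae_torus P2 -> ae_torus P3 -> ae_torus Q.
Proof.
rewrite /ae_torus => h; apply: (@filterS3 _ _ (ae_filter R)) => x h1 h2 h3 Dx.
by apply: h; [apply: h1|apply: h2|apply: h3].
Qed.

Lemma tintegrable_measurable (R : realType) (g : R -> R) :
  tintegrable g -> measurable_fun (torus R) g.
Proof. by move=> /measurable_int /measurable_EFinP. Qed.

Lemma tintegralE (R : realType) (g : R -> R) : tintegrable g ->
  (\int[@lebesgue_measure R]_(x in torus R) (g x)%:E)%E = (tintegral g)%:E.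
Proof.
move=> ig; rewrite /tintegral /Rintegral fineK//.
exact: (integrable_fin_num (@measurable_torus R)).
Qed.

Lemma le_tintegrable (R : realType) (g k : R -> R) :
  measurable_fun (torus R) g -> ae_torus (fun x => `|g x| <= k x) ->
  tintegrable k -> tintegrable g.
Proof.
move=> mg gk ik; apply/integrableP; split; first exact/measurable_EFinP.
move/integrableP : (ik) => [_]; apply: le_lt_trans.
have mk := tintegrable_measurable ik.
apply: (@ae_ge0_le_integral _ _ _ (@lebesgue_measure R) _ (@measurable_torus
  R)) => //=.
- by apply/measurable_EFinP; apply: measurableT_comp.
- by apply/measurable_EFinP; apply: measurableT_comp.
- move: gk; apply: (@filterS _ _ (ae_filter R)) => x h Dx; rewrite lee_fin.
  by rewrite (le_trans (h Dx))// ler_norm.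
Qed.

Lemma ge0_tintegrable (R : realType) (g : R -> R) :
  measurable_fun (torus R) g -> ae_torus (fun x => 0 <= g x) ->
  (\int[@lebesgue_measure R]_(x in torus R) (g x)%:E < +oo)%E ->
  tintegrable g.
Proof.
move=> mg g0 fg; apply/integrableP; split; first exact/measurable_EFinP.
rewrite (@ae_eq_integral _ _ _ (@lebesgue_measure R) _ (EFin \o g) _
  (@measurable_torus R))//=.
- by apply/measurable_EFinP; apply: measurableT_comp.
- exact/measurable_EFinP.
- by move: g0; apply: (@filterS _ _ (ae_filter R)) => x h Dx; rewrite /=
  ger0_norm// h.
Qed.

Lemma tintegrableD (R : realType) (g k : R -> R) :
  tintegrable g -> tintegrable k -> tintegrable (fun x => g x + k x).
Proof. exact: (@integrableD _ _ _ _ _ (@measurable_torus R)). Qed.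

Lemma tintegrableZ (R : realType) (c : R) (g : R -> R) :
  tintegrable g -> tintegrable (fun x => c * g x).
Proof. exact: (@integrableZl _ _ _ _ _ (@measurable_torus R)). Qed.

Lemma tintegrableN (R : realType) (g : R -> R) :
  tintegrable g -> tintegrable (fun x => - g x).
Proof. exact: integrableN. Qed.

Lemma tintegrableB (R : realType) (g k : R -> R) :
  tintegrable g -> tintegrable k -> tintegrable (fun x => g x - k x).
Proof. by move=> ig ik; apply: tintegrableD => //; apply: tintegrableN. Qed.

Lemma tintegrable_norm (R : realType) (g : R -> R) :
  tintegrable g -> tintegrable (fun x => `|g x|).
Proof. exact: integrable_abse. Qed.

Lemma tintegrable_cst (R : realType) (c : R) : tintegrable (fun _ : R => c).
Proof.
apply/integrableP; split; first exact: measurable_cst.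
rewrite [X in (X < _)%E](_ : _ = (`|c|%:E * (2 * pi)%:E)%E).
  by rewrite -EFinM ltry.
apply: (eq_trans (@integral_cst _ _ _ (@lebesgue_measure R) _
  (@measurable_torus R) `|c|%:E)).
by congr (_ * _)%E; apply: torus_measure.
Qed.

Lemma le_tintegral (R : realType) (g k : R -> R) :
  tintegrable g -> tintegrable k -> ae_torus (fun x => g x <= k x) ->
  tintegral g <= tintegral k.
Proof.
move=> ig ik gk; rewrite -subr_ge0 /tintegral -(@RintegralB _ _ _
  (@lebesgue_measure R))//.
have id : tintegrable (fun x => k x - g x) by exact: tintegrableB.
rewrite -lee_fin -/(tintegral _) -tintegralE//.
rewrite (@ae_eq_integral _ _ _ (@lebesgue_measure R) _ (fun x => `|k x - g
  x|%:E) (EFin \o (fun x => k x - g x)) (@measurable_torus R))//=.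
- exact: integral_ge0.
- exact: (measurable_int _ id).
- exact: (measurable_int _ (tintegrable_norm id)).
- by move: gk; apply: (@filterS _ _ (ae_filter R)) => x h Dx; rewrite /=
  ger0_norm// subr_ge0 h.
Qed.

Lemma eq_tintegral (R : realType) (g k : R -> R) :
  tintegrable g -> tintegrable k -> ae_torus (fun x => g x = k x) ->
  tintegral g = tintegral k.
Proof.
move=> ig ik gk; apply/eqP; rewrite eq_le !le_tintegral//;
  by move: gk; apply: ae_torusS => x ->.
Qed.

Lemma tintegralD (R : realType) (g k : R -> R) :
  tintegrable g -> tintegrable k ->
  tintegral (fun x => g x + k x) = tintegral g + tintegral k.
Proof. by move=> ig ik; rewrite /tintegral (@RintegralD _ _ _
  (@lebesgue_measure R)). Qed.

Lemma tintegralB (R : realType) (g k : R -> R) :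
  tintegrable g -> tintegrable k ->
  tintegral (fun x => g x - k x) = tintegral g - tintegral k.
Proof. by move=> ig ik; rewrite /tintegral (@RintegralB _ _ _
  (@lebesgue_measure R)). Qed.

Lemma tintegralZ (R : realType) (c : R) (g : R -> R) : tintegrable g ->
  tintegral (fun x => c * g x) = c * tintegral g.
Proof. by move=> ig; rewrite /tintegral (@RintegralZl _ _ _ (@lebesgue_measure
  R)). Qed.

Lemma tintegral_cst (R : realType) (c : R) :
  tintegral (fun _ : R => c) = c * (2 * pi).
Proof.
apply: (eq_trans (@Rintegral_cst _ _ _ (@lebesgue_measure R) _
  (@measurable_torus R) c)).
by congr (_ * _); apply: (congr1 fine (torus_measure R)).
Qed.

Lemma tintegral_ge0 (R : realType) (g : R -> R) :
  tintegrable g -> ae_torus (fun x => 0 <= g x) -> 0 <= tintegral g.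
Proof.
move=> ig g0; have := le_tintegral (tintegrable_cst 0) ig g0.
by rewrite tintegral_cst mul0r.
Qed.

Lemma tintegral_eq0 (R : realType) (g : R -> R) :
  tintegrable g -> ae_torus (fun x => 0 <= g x) -> tintegral g = 0 ->
  ae_torus (fun x => g x = 0).
Proof.
move=> ig g0 ig0.
have mg := tintegrable_measurable ig.
have : (\int[@lebesgue_measure R]_(x in torus R) `|(EFin \o g) x|)%E = 0%E.
  rewrite (@ae_eq_integral _ _ _ (@lebesgue_measure R) _ (EFin \o g) _
    (@measurable_torus R))//=.
  - by rewrite tintegralE// ig0.
  - by apply/measurable_EFinP; apply: measurableT_comp.
  - exact/measurable_EFinP.
  - by move: g0; apply: (@filterS _ _ (ae_filter R)) => x h Dx; rewrite /=
    ger0_norm// h.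
move/(ae_eq_integral_abs _ (@measurable_torus R) (measurable_int _ ig)).
by apply: (@filterS _ _ (ae_filter R)) => x h Dx; have [] := h Dx.
Qed.

(** Fatou's lemma is applied to the absolute values, which are nonnegative everywhere; these differ
    from the functions only on a null set. Since a convergent bound on the integrals suffices,
    integrability of the limit is a conclusion. The later passages to the limit under an integral
    sign rest on this form. *)
Lemma tintegral_fatou (R : realType) (g_ : nat -> R -> R) (g : R -> R)
    (K_ : nat -> R) (K : R) :
  (forall n, tintegrable (g_ n)) ->
  (forall n, ae_torus (fun x => 0 <= g_ n x)) ->
  measurable_fun (torus R) g ->
  ae_torus (fun x => g_ n x @[n --> \oo] --> g x) ->
  (forall n, tintegral (g_ n) <= K_ n) -> K_ n @[n --> \oo] --> K ->
  tintegrable g /\ tintegral g <= K.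
Proof.
move=> ig g0 mg cg gK cK.
have mn n : measurable_fun (torus R) (fun x => `|g_ n x|%:E).
  exact: (measurable_int _ (tintegrable_norm (ig n))).
have := fatou (@lebesgue_measure R) (@measurable_torus R) mn
  (fun n x _ => normr_ge0 _).
have fatouR : (limn_einf (fun n =>
    \int[@lebesgue_measure R]_(x in torus R) `|g_ n x|%:E) <= K%:E)%E.
  have -> : K%:E = limn_einf (EFin \o K_).
    by rewrite (cvg_limn_einf_sup (_ : (EFin \o K_) n @[n --> \oo] -->
      K%:E))//; apply/cvg_EFin => //; apply: nearW.
  rewrite !limn_einf_lim; apply: lee_lim; [exact: is_cvg_einfs..|].
  apply: nearW => n; apply: le_ereal_inf_tmp => _ [m /= nm <-].
  apply: ereal_inf_le; exists (\int[@lebesgue_measure R]_(x in torus R) `|g_ m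
    x|%:E)%E.
    by exists m.
  move: (m) => {nm n m} n.
  rewrite (@ae_eq_integral _ _ _ (@lebesgue_measure R) _ (EFin \o g_ n) _
    (@measurable_torus R))//=.
  - by rewrite tintegralE// lee_fin.
  - exact: mn.
  - exact: (measurable_int _ (ig n)).
  - by move: (g0 n); apply: (@filterS _ _ (ae_filter R)) => x h Dx; rewrite /=
    ger0_norm// h.
have aeg : ae_torus (fun x => limn_einf (fun n => `|g_ n x|%:E) = `|g x|%:E).
  move: cg; apply: ae_torusS => x cx.
  rewrite (cvg_limn_einf_sup (_ : _ --> `|g x|%:E))//.
  apply/cvg_EFin; first exact: nearW.
  exact: cvg_norm.
have g0' : ae_torus (fun x => 0 <= g x).
  have : ae_torus (fun x => forall n, 0 <= g_ n x).
    suff : \forall x \ae @lebesgue_measure R, forall n, torus R x -> 0 <= g_ n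
      x.
      by apply: (@filterS _ _ (ae_filter R)) => x h Dx n; apply: h.
    exact: (@ae_foralln _ _ _ (@lebesgue_measure R)).
  move: cg; apply: ae_torusS2 => x cx h.
  rewrite -(cvg_lim (@Rhausdorff R) cx); apply: limr_ge; [exact: cvgP cx|].
  exact: nearW.
move=> fat.
have gK' : (\int[@lebesgue_measure R]_(x in torus R) (g x)%:E <= K%:E)%E.
  apply: le_trans fatouR; apply: le_trans fat.
  have ml : measurable_fun (torus R) (fun x => limn_einf (fun n => `|g_ n
    x|%:E)).
    rewrite /limn_einf; apply: measurableT_comp => //.
    by apply: measurable_fun_limn_esup => n; apply: measurableT_comp.
  rewrite [leLHS](@ae_eq_integral _ _ _ (@lebesgue_measure R) _ (fun x =>
    limn_einf (fun n => `|g_ n x|%:E)) _ (@measurable_torus R))//=.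
  - exact/measurable_EFinP.
  - move: aeg g0'; apply: (@filterS2 _ _ (ae_filter R)) => x h1 h2 Dx /=.
    by rewrite h1// ger0_norm// h2.
have igg : tintegrable g.
  by apply: ge0_tintegrable => //; apply: le_lt_trans gK' _; rewrite ltry.
by split=> //; rewrite -lee_fin -tintegralE.
Qed.

(** * Complex arithmetic by real and imaginary parts *)

Lemma ReD (R : realType) (x y : R[i]) :
  complex.Re (x + y) = complex.Re x + complex.Re y.
Proof. by case: x; case: y. Qed.

Lemma ImD (R : realType) (x y : R[i]) :
  complex.Im (x + y) = complex.Im x + complex.Im y.
Proof. by case: x; case: y. Qed.

Lemma ReN (R : realType) (x : R[i]) : complex.Re (- x) = - complex.Re x.
Proof. by case: x. Qed.

Lemma ImN (R : realType) (x : R[i]) : complex.Im (- x) = - complex.Im x.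
Proof. by case: x. Qed.

Lemma ReM (R : realType) (x y : R[i]) :
  complex.Re (x * y) =
  complex.Re x * complex.Re y - complex.Im x * complex.Im y.
Proof. by case: x; case: y. Qed.

Lemma ImM (R : realType) (x y : R[i]) :
  complex.Im (x * y) =
  complex.Re x * complex.Im y + complex.Im x * complex.Re y.
Proof. by case: x; case: y. Qed.

Lemma ReJ (R : realType) (x : R[i]) : complex.Re (conjc x) = complex.Re x.
Proof. by case: x. Qed.

Lemma ImJ (R : realType) (x : R[i]) : complex.Im (conjc x) = - complex.Im x.
Proof. by case: x. Qed.

Lemma complex_eq (R : realType) (x y : R[i]) :
  complex.Re x = complex.Re y -> complex.Im x = complex.Im y -> x = y.
Proof. by case: x => a b; case: y => c d /= -> ->. Qed.

Definition reim := (ReD, ImD, ReN, ImN, ReM, ImM, ReJ, ImJ).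

(** The squared modulus without the square root of [modulus]: being polynomial in the two parts, it
    is within reach of [ring], [field] and [nra]. *)
Definition nsq (R : realType) (z : R[i]) : R :=
  complex.Re z ^+ 2 + complex.Im z ^+ 2.

Lemma sqr_modulus (R : realType) (z : R[i]) : modulus z ^+ 2 = nsq z.
Proof.
by case: z => a b; rewrite /modulus /= sqr_sqrtr// addr_ge0 ?sqr_ge0.
Qed.

Lemma nsq_ge0 (R : realType) (z : R[i]) : 0 <= nsq z.
Proof. by rewrite addr_ge0 ?sqr_ge0. Qed.

Lemma nsq_eq0 (R : realType) (z : R[i]) : nsq z = 0 -> z = 0.
Proof.
move/eqP; rewrite paddr_eq0 ?sqr_ge0// !sqrf_eq0 => /andP[/eqP a /eqP b].
exact: complex_eq.
Qed.

Lemma nsqM (R : realType) (z w : R[i]) : nsq (z * w) = nsq z * nsq w.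
Proof. by rewrite /nsq !reim; ring. Qed.

Lemma nsqN (R : realType) (z : R[i]) : nsq (- z) = nsq z.
Proof. by rewrite /nsq !reim !sqrrN. Qed.

Lemma nsq_real (R : realType) (r : R) : nsq r%:C = r ^+ 2.
Proof. by rewrite /nsq /= expr0n addr0. Qed.

Lemma nsqD_le (R : realType) (z w : R[i]) : nsq (z + w) <= 2 * nsq z + 2 * nsq
  w.
Proof.
rewrite /nsq !reim -subr_ge0.
have := sqr_ge0 (complex.Re z - complex.Re w).
by have := sqr_ge0 (complex.Im z - complex.Im w); nra.
Qed.

(** The defect is |t z - w|^2 / t. This stands in for the triangle inequality: with small [t] the
    factor of |z|^2 is as close to 1 as desired. *)
Lemma nsqD_le_scaled (R : realType) (t : R) (z w : R[i]) : 0 < t ->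
  nsq (z + w) <= (1 + t) * nsq z + (1 + t^-1) * nsq w.
Proof.
move=> t0; rewrite -subr_ge0.
have -> : (1 + t) * nsq z + (1 + t^-1) * nsq w - nsq (z + w) =
    t^-1 * nsq (t%:C * z - w).
  by rewrite /nsq !reim /=; field; rewrite gt_eqF.
by rewrite mulr_ge0 ?nsq_ge0// invr_ge0 ltW.
Qed.

Lemma normr_Re_le (R : realType) (z : R[i]) : `|complex.Re z| <= 1 + nsq z.
Proof.
rewrite /nsq; have := sqr_ge0 (complex.Im z).
rewrite -(real_normK (num_real (complex.Re z))).
by have := normr_ge0 (complex.Re z); nra.
Qed.

Lemma normr_Im_le (R : realType) (z : R[i]) : `|complex.Im z| <= 1 + nsq z.
Proof.
rewrite /nsq; have := sqr_ge0 (complex.Re z).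
rewrite -(real_normK (num_real (complex.Im z))).
by have := normr_ge0 (complex.Im z); nra.
Qed.

(** * Complex integrals and measurability *)

Definition ctintegrable (R : realType) (h : R -> R[i]) : Prop :=
  tintegrable (fun x => complex.Re (h x)) /\
  tintegrable (fun x => complex.Im (h x)).

Lemma ctintegrable_measurable (R : realType) (h : R -> R[i]) :
  ctintegrable h -> cmeasurable h.
Proof. by move=> [a b]; split; exact: tintegrable_measurable. Qed.

Lemma cintegralE (R : realType) (h : R -> R[i]) :
  cintegral h = tintegral (fun x => complex.Re (h x)) +i*
                tintegral (fun x => complex.Im (h x)).
Proof. by []. Qed.

Lemma ctintegrableD (R : realType) (h k : R -> R[i]) :
  ctintegrable h -> ctintegrable k -> ctintegrable (fun x => h x + k x).
Proof.
move=> [h1 h2] [k1 k2]; split.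
- by rewrite (_ : (fun _ => _) = fun x => complex.Re (h x) + complex.Re (k x));
    [exact: tintegrableD|apply/funext => x; rewrite reim].
- by rewrite (_ : (fun _ => _) = fun x => complex.Im (h x) + complex.Im (k x));
    [exact: tintegrableD|apply/funext => x; rewrite reim].
Qed.

Lemma cintegralD (R : realType) (h k : R -> R[i]) :
  ctintegrable h -> ctintegrable k ->
  cintegral (fun x => h x + k x) = cintegral h + cintegral k.
Proof.
move=> [h1 h2] [k1 k2]; rewrite !cintegralE.
apply: complex_eq => /=; rewrite -tintegralD//;
  by congr tintegral; apply/funext => x; rewrite reim.
Qed.

Lemma ctintegrableZ (R : realType) (c : R[i]) (h : R -> R[i]) :
  ctintegrable h -> ctintegrable (fun x => c * h x).
Proof.
move=> [h1 h2]; split.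
- rewrite (_ : (fun _ => _) = fun x => complex.Re c * complex.Re (h x) -
    complex.Im c * complex.Im (h x));
    last by apply/funext => x; rewrite reim.
  by apply: tintegrableB; apply: tintegrableZ.
- rewrite (_ : (fun _ => _) = fun x => complex.Re c * complex.Im (h x) +
    complex.Im c * complex.Re (h x));
    last by apply/funext => x; rewrite reim.
  by apply: tintegrableD; apply: tintegrableZ.
Qed.

Lemma cintegralZ (R : realType) (c : R[i]) (h : R -> R[i]) : ctintegrable h ->
  cintegral (fun x => c * h x) = c * cintegral h.
Proof.
move=> [h1 h2]; rewrite !cintegralE; apply: complex_eq; rewrite reim /=.
- rewrite -!tintegralZ// -tintegralB; [|exact: tintegrableZ..].
  by congr tintegral; apply/funext => x; rewrite reim.
- rewrite -!tintegralZ// -tintegralD; [|exact: tintegrableZ..].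
  by congr tintegral; apply/funext => x; rewrite reim.
Qed.

Lemma ctintegrable0 (R : realType) : ctintegrable (fun _ : R => 0 : R[i]).
Proof. by split; exact: tintegrable_cst. Qed.

Lemma cintegral0 (R : realType) : cintegral (fun _ : R => 0 : R[i]) = 0.
Proof. by rewrite cintegralE !tintegral_cst !mul0r. Qed.

Lemma ctintegrable_sum (R : realType) (I : Type) (s : seq I)
    (h : I -> R -> R[i]) : (forall i, ctintegrable (h i)) ->
  ctintegrable (fun x => \sum_(i <- s) h i x).
Proof.
move=> ih; elim: s => [|i s ihs].
  by under eq_fun do rewrite big_nil; exact: ctintegrable0.
by under eq_fun do rewrite big_cons; apply: ctintegrableD.
Qed.

Lemma cintegral_sum (R : realType) (I : Type) (s : seq I)
    (h : I -> R -> R[i]) : (forall i, ctintegrable (h i)) ->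
  cintegral (fun x => \sum_(i <- s) h i x) = \sum_(i <- s) cintegral (h i).
Proof.
move=> ih; elim: s => [|i s ihs].
  by under eq_fun do rewrite big_nil; rewrite big_nil cintegral0.
under eq_fun do rewrite big_cons.
by rewrite cintegralD ?ihs ?big_cons//; exact: ctintegrable_sum.
Qed.

Lemma cmeasurableD (R : realType) (h k : R -> R[i]) :
  cmeasurable h -> cmeasurable k -> cmeasurable (fun x => h x + k x).
Proof.
move=> [h1 h2] [k1 k2]; split.
- by under eq_fun do rewrite reim; exact: measurable_funD.
- by under eq_fun do rewrite reim; exact: measurable_funD.
Qed.

Lemma cmeasurableM (R : realType) (h k : R -> R[i]) :
  cmeasurable h -> cmeasurable k -> cmeasurable (fun x => h x * k x).
Proof.
move=> [h1 h2] [k1 k2]; split.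
- by under eq_fun do rewrite reim;
    apply: measurable_funB; apply: measurable_funM.
- by under eq_fun do rewrite reim;
    apply: measurable_funD; apply: measurable_funM.
Qed.

Lemma cmeasurable_cst (R : realType) (c : R[i]) : cmeasurable (fun _ : R => c).
Proof. by split; exact: measurable_cst. Qed.

Lemma cmeasurableB (R : realType) (h k : R -> R[i]) :
  cmeasurable h -> cmeasurable k -> cmeasurable (fun x => h x - k x).
Proof.
move=> mh mk; under eq_fun do rewrite -[- k _]mulN1r.
by apply: cmeasurableD => //; apply: cmeasurableM => //; exact: cmeasurable_cst.
Qed.

Lemma cmeasurable_sum (R : realType) (I : Type) (s : seq I)
    (h : I -> R -> R[i]) : (forall i, cmeasurable (h i)) ->
  cmeasurable (fun x => \sum_(i <- s) h i x).
Proof.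
move=> ih; elim: s => [|i s ihs].
  by under eq_fun do rewrite big_nil; exact: cmeasurable_cst.
by under eq_fun do rewrite big_cons; apply: cmeasurableD.
Qed.

Lemma measurable_nsq (R : realType) (h : R -> R[i]) : cmeasurable h ->
  measurable_fun (torus R) (fun x => nsq (h x)).
Proof.
by move=> [h1 h2]; apply: measurable_funD; apply: measurable_funX.
Qed.

Lemma tintegrableM_bounded (R : realType) (g k : R -> R) (M : R) :
  tintegrable g -> measurable_fun (torus R) k ->
  ae_torus (fun x => `|k x| <= M) -> tintegrable (fun x => g x * k x).
Proof.
move=> ig mk kM; apply: (@le_tintegrable _ _ (fun x => M * `|g x|)).
- by apply: measurable_funM => //; exact: tintegrable_measurable.
- move: kM; apply: ae_torusS => x h.
  by rewrite normrM mulrC ler_wpM2r.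
- by apply: tintegrableZ; exact: tintegrable_norm.
Qed.

Lemma ctintegrableM_bounded (R : realType) (h k : R -> R[i]) (M : R) :
  ctintegrable h -> cmeasurable k -> ae_torus (fun x => nsq (k x) <= M) ->
  ctintegrable (fun x => h x * k x).
Proof.
move=> [h1 h2] [k1 k2] kM.
have kr : ae_torus (fun x => `|complex.Re (k x)| <= 1 + M).
  by move: kM; apply: ae_torusS => x; have := normr_Re_le (k x); lra.
have ki : ae_torus (fun x => `|complex.Im (k x)| <= 1 + M).
  by move: kM; apply: ae_torusS => x; have := normr_Im_le (k x); lra.
split.
- under eq_fun do rewrite reim.
  by apply: tintegrableB; apply: tintegrableM_bounded; eassumption.
- under eq_fun do rewrite reim.
  by apply: tintegrableD; apply: tintegrableM_bounded; eassumption.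
Qed.

(** * Exponentials and their orthogonality *)

Lemma expiD (R : realType) (s t : R) : expi (s + t) = expi s * expi t.
Proof.
by apply: complex_eq; rewrite reim /= ?cosD ?sinD//; ring.
Qed.

Lemma expi0 (R : realType) : expi (0 : R) = 1.
Proof. by rewrite /expi cos0 sin0. Qed.

Lemma conj_expi (R : realType) (t : R) : conjc (expi t) = expi (- t).
Proof. by rewrite /expi cosN sinN. Qed.

Lemma nsq_expi (R : realType) (t : R) : nsq (expi t) = 1.
Proof. by rewrite /nsq /= cos2Dsin2. Qed.

Lemma cmeasurable_expi (R : realType) (k : R) :
  cmeasurable (fun x => expi (k * x)).
Proof.
have mk : measurable_fun (torus R) (fun x : R => k * x).
  by apply: measurable_funM => //; exact: measurable_id.
split=> /=.
- by apply: (measurableT_comp (f := @cos R)) => //; apply: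
  continuous_measurable_fun; exact: continuous_cos.
- by apply: (measurableT_comp (f := @sin R)) => //; apply:
  continuous_measurable_fun; exact: continuous_sin.
Qed.

Lemma ctintegrableM_expi (R : realType) (h : R -> R[i]) (k : R) :
  ctintegrable h -> ctintegrable (fun x => h x * expi (k * x)).
Proof.
move=> ih; apply: (@ctintegrableM_bounded _ _ _ 1) => //.
- exact: cmeasurable_expi.
- by apply: ae_torusW => x; rewrite nsq_expi.
Qed.

Lemma ctintegrable_cst (R : realType) (c : R[i]) : ctintegrable (fun _ : R =>
  c).
Proof. by split; exact: tintegrable_cst. Qed.

Lemma ctintegrable_expi (R : realType) (k : R) :
  ctintegrable (fun x => expi (k * x)).
Proof.
have := ctintegrableM_expi k (ctintegrable_cst (1 : R[i])).
by under eq_fun do rewrite mul1r.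
Qed.

Lemma tintegral_derive (R : realType) (F f : R -> R) :
  (forall x, is_derive x (1 : R) F (f x)) -> continuous f -> tintegrable f ->
  tintegral f = F pi - F (- pi).
Proof.
move=> dF cf jf; have pi0 := pi_gt0 R.
have cF : continuous F.
  move=> x; apply: differentiable_continuous; apply/derivable1_diffP.
  exact: (@ex_derive _ _ _ _ _ _ _ (dF x)).
have := @continuous_FTC2 R f F (- pi) pi.
move=> FTC; apply: EFin_inj; rewrite -tintegralE// EFinB; apply: FTC.
- lra.
- exact: continuous_subspaceT.
- split => [x _||].
  + exact: (@ex_derive _ _ _ _ _ _ _ (dF x)).
  + by apply: cvg_at_right_filter; exact: cF.
  + by apply: cvg_at_left_filter; exact: cF.
- by move=> x _; rewrite derive1E; exact: (@derive_val _ _ _ _ _ _ _ (dF x)).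
Qed.

Lemma sin_intpi (R : realType) (k : int) : sin (k%:~R * pi) = 0 :> R.
Proof.
have nat n : sin (n%:R * pi) = 0 :> R.
  by elim: n => [|n ih]; rewrite ?mul0r ?sin0// -natr1 mulrDl mul1r sinDpi ih
    oppr0.
by case: k => n; rewrite ?NegzE ?mulrNz ?mulNr ?sinN -?pmulrn ?nat ?oppr0.
Qed.

Lemma cintegral_expi (R : realType) (k : int) :
  cintegral (fun x => expi (k%:~R * x)) = (if k == 0 then 2 * pi else 0 : R)%:C.
Proof.
have [->|k0] := eqVneq k 0.
  under eq_fun do rewrite mul0r expi0.
  by rewrite cintegralE /= !tintegral_cst mul1r mul0r.
have [i1 i2] := ctintegrable_expi (k%:~R : R).
have k0' : k%:~R != 0 :> R by rewrite intr_eq0.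
have ck : continuous (fun x : R => k%:~R * x).
  by move=> x; apply: cvgM; [exact: cvg_cst|exact: cvg_id].
have dF x : is_derive x (1 : R) (fun x => k%:~R^-1 * sin (k%:~R * x))
    (cos (k%:~R * x)).
  apply: is_derive_eq.
  by rewrite /GRing.scale /=; field.
have dG x : is_derive x (1 : R) (fun x => - k%:~R^-1 * cos (k%:~R * x))
    (sin (k%:~R * x)).
  apply: is_derive_eq.
  by rewrite /GRing.scale /=; field.
rewrite cintegralE; apply: complex_eq => /=.
- rewrite (tintegral_derive dF)//.
  + by rewrite mulrN sinN sin_intpi; ring.
  + by move=> x; apply: continuous_comp; [exact: ck|exact: continuous_cos].
- rewrite (tintegral_derive dG)//.
  + by rewrite mulrN cosN; ring.
  + by move=> x; apply: continuous_comp; [exact: ck|exact: continuous_sin].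
Qed.

(** * Trigonometric polynomials *)

(** Frequencies may repeat with different coefficients, so a sum is a concatenation and a product
    runs over all pairs. *)
Definition trigp (R : realType) (l : seq (int * R[i])) (x : R) : R[i] :=
  \sum_(q <- l) q.2 * expi (q.1%:~R * x).

Lemma observed_polyP (R : realType) (N : nat) (p : R -> R[i]) :
  observed_poly N p <->
  exists l, all (fun q => ~~ (0 <= q.1 <= N%:Z)) l /\ p = trigp l.
Proof.
split=> [[s [c [sN pE]]]|[l [lN ->]]].
  exists [seq (j, c j) | j <- s]; split.
    by apply/allP => q /mapP[j js ->] /=; exact: sN.
  by apply/funext => x; rewrite pE /trigp big_map.
(* [observed_poly] has one coefficient per frequency, so repeated frequencies are merged and their
   coefficients added. *)
exists (undup [seq q.1 | q <- l]), (fun j => \sum_(q <- l | q.1 == j) q.2).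
split=> [j|x].
  by rewrite mem_undup => /mapP[q ql ->]; exact: (allP lN).
under eq_bigr do rewrite mulr_suml.
rewrite (exchange_big_dep xpredT)//= /trigp big_seq [RHS]big_seq.
apply: eq_bigr => q ql.
under eq_bigl do rewrite eq_sym.
rewrite -big_filter filter_pred1_uniq ?undup_uniq ?big_seq1//.
by rewrite mem_undup; apply/mapP; exists q.
Qed.

Lemma observed_polyD (R : realType) (N : nat) (p q : R -> R[i]) :
  observed_poly N p -> observed_poly N q ->
  observed_poly N (fun x => p x + q x).
Proof.
move=> /observed_polyP[l [lN ->]] /observed_polyP[m [mN ->]].
apply/observed_polyP; exists (l ++ m); rewrite all_cat lN mN; split=> //.
by apply/funext => x; rewrite /trigp big_cat.
Qed.

Lemma observed_polyZ (R : realType) (N : nat) (c : R[i]) (p : R -> R[i]) :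
  observed_poly N p -> observed_poly N (fun x => c * p x).
Proof.
move=> /observed_polyP[l [lN ->]].
apply/observed_polyP; exists [seq (q.1, c * q.2) | q <- l]; split.
  by rewrite all_map.
apply/funext => x; rewrite /trigp big_map mulr_sumr.
by apply: eq_bigr => q _; rewrite mulrA.
Qed.

Lemma observed_poly0 (R : realType) (N : nat) :
  observed_poly N (fun _ : R => 0 : R[i]).
Proof.
apply/observed_polyP; exists [::]; split=> //.
by apply/funext => x; rewrite /trigp big_nil.
Qed.

Lemma observed_expi (R : realType) (N : nat) (j : int) :
  ~~ (0 <= j <= N%:Z) -> observed_poly N (fun x : R => expi (j%:~R * x)).
Proof.
move=> jN; apply/observed_polyP; exists [:: (j, 1)]; rewrite /= jN; split=> //.
by apply/funext => x; rewrite /trigp big_seq1 mul1r.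
Qed.

Lemma cmeasurable_trigp (R : realType) (l : seq (int * R[i])) :
  cmeasurable (trigp l).
Proof.
apply: cmeasurable_sum => q; apply: cmeasurableM.
  exact: cmeasurable_cst.
exact: cmeasurable_expi.
Qed.

Lemma bounded_trigp (R : realType) (l : seq (int * R[i])) :
  exists M, forall x, nsq (trigp l x) <= M.
Proof.
elim: l => [|q l [M ih]].
  by exists 0 => x; rewrite /trigp big_nil /nsq /= expr0n addr0.
exists (2 * nsq q.2 + 2 * M) => x; rewrite /trigp big_cons.
apply: le_trans (nsqD_le _ _) _.
by rewrite nsqM nsq_expi mulr1; have := ih x; rewrite /trigp; lra.
Qed.

Lemma trig_polyE (R : realType) (N : nat) (c : 'cV[R[i]]_N.+1) :
  trig_poly c = trigp [seq (j%:Z, c j 0) | j : 'I_N.+1 <- index_enum 'I_N.+1].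
Proof. by apply/funext => x; rewrite /trigp big_map. Qed.

(** * The weighted space L_2(f) and its subspace of observed functions *)

Definition inL2 (R : realType) (f : R -> R) (h : R -> R[i]) : Prop :=
  cmeasurable h /\ tintegrable (fun x => nsq (h x) * f x).

Definition wnorm (R : realType) (f : R -> R) (h : R -> R[i]) : R :=
  tintegral (fun x => nsq (h x) * f x).

Lemma sqnormL2E (R : realType) (f : R -> R) (h : R -> R[i]) :
  inL2 f h -> sqnormL2 f h = (wnorm f h)%:E.
Proof.
move=> [_ ih]; rewrite -tintegralE// /sqnormL2.
by apply: eq_integral => x _; rewrite sqr_modulus.
Qed.

Lemma nsqM_ge0 (R : realType) (f : R -> R) (h : R -> R[i]) :
  spectral_density f -> ae_torus (fun x => 0 <= nsq (h x) * f x).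
Proof.
by move=> [f0 _]; move: f0; apply: ae_torusS => x; apply: mulr_ge0; exact:
  nsq_ge0.
Qed.

Lemma measurable_nsqM (R : realType) (f : R -> R) (h : R -> R[i]) :
  spectral_density f -> cmeasurable h ->
  measurable_fun (torus R) (fun x => nsq (h x) * f x).
Proof.
move=> [_ /tintegrable_measurable mf] mh.
by apply: measurable_funM => //; exact: measurable_nsq.
Qed.

Lemma sqnormL2_inL2 (R : realType) (f : R -> R) (h : R -> R[i]) :
  spectral_density f -> cmeasurable h -> (sqnormL2 f h < +oo)%E -> inL2 f h.
Proof.
move=> sf mh fh; split=> //; apply: ge0_tintegrable.
- exact: measurable_nsqM.
- exact: nsqM_ge0.
- move: fh; rewrite /sqnormL2.
  by under eq_integral do rewrite sqr_modulus.
Qed.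

Lemma wnorm_ge0 (R : realType) (f : R -> R) (h : R -> R[i]) :
  spectral_density f -> inL2 f h -> 0 <= wnorm f h.
Proof. by move=> sf [_ ih]; apply: tintegral_ge0 => //; exact: nsqM_ge0. Qed.

Lemma le_inL2 (R : realType) (f : R -> R) (g h : R -> R[i]) (c : R) :
  spectral_density f -> cmeasurable g ->
  ae_torus (fun x => nsq (g x) <= c * nsq (h x)) -> inL2 f h -> inL2 f g.
Proof.
move=> sf mg gh [mh ih]; split=> //.
apply: (@le_tintegrable _ _ (fun x => c * (nsq (h x) * f x))).
- exact: measurable_nsqM.
- move: sf gh => [f0 _]; move: f0; apply: ae_torusS2 => x f0 gh.
  by rewrite ger0_norm ?mulr_ge0 ?nsq_ge0// mulrA ler_wpM2r.
- exact: tintegrableZ.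
Qed.

Lemma bounded_inL2 (R : realType) (f : R -> R) (h : R -> R[i]) (M : R) :
  spectral_density f -> cmeasurable h -> ae_torus (fun x => nsq (h x) <= M) ->
  inL2 f h.
Proof.
move=> sf mh hM; apply: (@le_inL2 _ _ _ (fun=> 1) M) => //.
  by move: hM; apply: ae_torusS => x; rewrite nsq_real expr1n mulr1.
split; first exact: cmeasurable_cst.
under eq_fun do rewrite nsq_real expr1n mul1r.
by case: sf.
Qed.

Lemma trigp_inL2 (R : realType) (f : R -> R) (l : seq (int * R[i])) :
  spectral_density f -> inL2 f (trigp l).
Proof.
move=> sf; have [M lM] := bounded_trigp l.
apply: (@bounded_inL2 _ _ _ M) => //; first exact: cmeasurable_trigp.
exact: ae_torusW.
Qed.

Lemma trig_poly_inL2 (R : realType) (f : R -> R) (N : nat)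
    (c : 'cV[R[i]]_N.+1) : spectral_density f -> inL2 f (trig_poly c).
Proof. by rewrite trig_polyE; exact: trigp_inL2. Qed.

Lemma observed_inL2 (R : realType) (f : R -> R) (N : nat) (p : R -> R[i]) :
  spectral_density f -> observed_poly N p -> inL2 f p.
Proof. by move=> sf /observed_polyP[l [_ ->]]; exact: trigp_inL2. Qed.

Lemma inL2D (R : realType) (f : R -> R) (g h : R -> R[i]) :
  spectral_density f -> inL2 f g -> inL2 f h -> inL2 f (fun x => g x + h x).
Proof.
move=> sf [mg ig] [mh ih]; split; first exact: cmeasurableD.
apply: (@le_tintegrable _ _
  (fun x => 2 * (nsq (g x) * f x) + 2 * (nsq (h x) * f x))).
- by apply: measurable_nsqM => //; exact: cmeasurableD.
- move: sf => [f0 _]; move: f0; apply: ae_torusS => x f0.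
  rewrite ger0_norm ?mulr_ge0 ?nsq_ge0// !mulrA -mulrDl ler_wpM2r//.
  exact: nsqD_le.
- by apply: tintegrableD; exact: tintegrableZ.
Qed.

Lemma inL2Z (R : realType) (f : R -> R) (c : R[i]) (h : R -> R[i]) :
  spectral_density f -> inL2 f h -> inL2 f (fun x => c * h x).
Proof.
move=> sf ih; apply: (@le_inL2 _ _ _ h (nsq c)) => //.
  by case: ih => mh _; apply: cmeasurableM => //; exact: cmeasurable_cst.
by apply: ae_torusW => x; rewrite nsqM.
Qed.

Lemma inL2B (R : realType) (f : R -> R) (g h : R -> R[i]) :
  spectral_density f -> inL2 f g -> inL2 f h -> inL2 f (fun x => g x - h x).
Proof.
move=> sf ig ih; under eq_fun do rewrite -[- h _]mulN1r.
by apply: inL2D => //; exact: inL2Z.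
Qed.

Lemma L2NP (R : realType) (N : nat) (f : R -> R) (h : R -> R[i]) :
  spectral_density f ->
  L2N N f h <-> inL2 f h /\ forall eps : R, 0 < eps ->
    exists p, observed_poly N p /\ wnorm f (fun x => h x - p x) < eps.
Proof.
move=> sf; split=> [[mh [fh ah]]|[ih ah]].
  have ih : inL2 f h by exact: sqnormL2_inL2.
  split=> // e e0; have [p [op pe]] := ah _ e0; exists p; split=> //.
  rewrite -lte_fin -sqnormL2E//; apply: inL2B => //; exact: observed_inL2 op.
split; first by case: ih.
split; first by rewrite sqnormL2E ?ltry.
move=> e e0; have [p [op pe]] := ah _ e0; exists p; split=> //.
by rewrite sqnormL2E ?lte_fin//; apply: inL2B => //; exact: observed_inL2 op.
Qed.

Lemma wnormD_le (R : realType) (f : R -> R) (t : R) (g h : R -> R[i]) :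
  spectral_density f -> 0 < t -> inL2 f g -> inL2 f h ->
  wnorm f (fun x => g x + h x) <= (1 + t) * wnorm f g + (1 + t^-1) * wnorm f h.
Proof.
move=> sf t0 ig ih.
have [_ i1] := ig; have [_ i2] := ih; have [_ i3] := inL2D sf ig ih.
rewrite /wnorm -!tintegralZ// -tintegralD; [|exact: tintegrableZ..].
apply: le_tintegral => //.
  by apply: tintegrableD; exact: tintegrableZ.
case: sf => f0 _; move: f0; apply: ae_torusS => x f0.
by rewrite !mulrA -mulrDl ler_wpM2r// nsqD_le_scaled.
Qed.

(** Let [e] tend to 0 with [t] fixed, then [t] tend to 0. *)
Lemma le_from_scaled (R : realType) (d W : R) : 0 <= W ->
  (forall t e : R, 0 < t -> 0 < e -> d <= (1 + t) * W + (1 + t^-1) * e) ->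
  d <= W.
Proof.
move=> W0 h.
have h2 t : 0 < t -> d <= (1 + t) * W.
  move=> t0; apply/ler_addgt0Pr => e e0.
  have t1 : 0 < 1 + t^-1 by rewrite addr_gt0// invr_gt0.
  have := h t (e / (1 + t^-1)) t0 (divr_gt0 e0 t1).
  by rewrite mulrCA divff ?gt_eqF// mulr1.
apply/ler_addgt0Pr => e e0.
(* [W] may vanish, so t = e / (W + 1) is taken instead of e / W. *)
have W1 : 0 < W + 1 by rewrite ltr_wpDl.
have := h2 (e / (W + 1)) (divr_gt0 e0 W1).
have : e / (W + 1) * W <= e.
  by rewrite mulrAC ler_pdivrMr// ler_pM2l//; lra.
by rewrite mulrDl mul1r; lra.
Qed.

(** A bound on distances to observed polynomials survives the closure: H - p is (H - g) + (g - p)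
    with the last term as small as desired, and the scaled inequality loses nothing in the limit. *)
Lemma L2N_lower_bound (R : realType) (N : nat) (f : R -> R)
    (H g : R -> R[i]) (d : R) :
  spectral_density f -> inL2 f H ->
  (forall p, observed_poly N p -> d <= wnorm f (fun x => H x - p x)) ->
  L2N N f g -> d <= wnorm f (fun x => H x - g x).
Proof.
move=> sf iH dp /(L2NP _ _ sf)[ig ag].
have iHg := inL2B sf iH ig.
apply: le_from_scaled; first exact: wnorm_ge0.
move=> t e t0 e0; have [p [op pe]] := ag _ e0.
have igp := inL2B sf ig (observed_inL2 sf op).
apply: le_trans (dp _ op) _.
have := wnormD_le sf t0 iHg igp.
have -> : (fun x => H x - g x + (g x - p x)) = fun x => H x - p x.
  by apply/funext => x; rewrite addrA subrK.
move/le_trans; apply; rewrite lerD2l ler_wpM2l//; last exact: ltW.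
by rewrite addr_ge0// invr_ge0 ltW.
Qed.

(** * Existence of the projection in L_2(f) *)

Lemma wnorm_parallelogram (R : realType) (f : R -> R) (H p q : R -> R[i]) :
  spectral_density f -> inL2 f H -> inL2 f p -> inL2 f q ->
  wnorm f (fun x => p x - q x) +
    4 * wnorm f (fun x => H x - (2^-1)%:C * (p x + q x)) =
  2 * wnorm f (fun x => H x - p x) + 2 * wnorm f (fun x => H x - q x).
Proof.
move=> sf iH ip iq.
have [_ i1] := inL2B sf ip iq.
have [_ i2] := inL2B sf iH (inL2Z (2^-1)%:C sf (inL2D sf ip iq)).
have [_ i3] := inL2B sf iH ip.
have [_ i4] := inL2B sf iH iq.
rewrite /wnorm -!tintegralZ// -!tintegralD//; try exact: tintegrableZ.
by congr tintegral; apply/funext => x; rewrite /nsq !reim /=; field.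
Qed.

(** The midpoint of [p] and [q] is again observed, hence at squared distance at least [d] from [H];
    the parallelogram law then leaves at most 2 (a + b) for p - q. *)
Lemma near_minimizer_dist (R : realType) (N : nat) (f : R -> R)
    (H p q : R -> R[i]) (d a b : R) :
  spectral_density f -> inL2 f H ->
  (forall p, observed_poly N p -> d <= wnorm f (fun x => H x - p x)) ->
  observed_poly N p -> wnorm f (fun x => H x - p x) <= d + a ->
  observed_poly N q -> wnorm f (fun x => H x - q x) <= d + b ->
  wnorm f (fun x => p x - q x) <= 2 * (a + b).
Proof.
move=> sf iH dp op pa oq qb.
have := wnorm_parallelogram sf iH (observed_inL2 sf op) (observed_inL2 sf oq).
have := dp _ (observed_polyZ (2^-1)%:C (observed_polyD op oq)).
by move: pa qb; lra.
Qed.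

(* The upper limit is measurable even where the sequence, known to converge
   only almost everywhere, diverges. *)
Definition esup_limit (R : realType) (g_ : nat -> R -> R) (x : R) : R :=
  fine (limn_esup (fun n => (g_ n x)%:E)).

Lemma measurable_esup_limit (R : realType) (g_ : nat -> R -> R) :
  (forall n, measurable_fun (torus R) (g_ n)) ->
  measurable_fun (torus R) (esup_limit g_).
Proof.
move=> mg; apply: measurableT_comp => //.
by apply: measurable_fun_limn_esup => n; apply/measurable_EFinP.
Qed.

Lemma esup_limit_cvg (R : realType) (g_ : nat -> R -> R) (x : R) :
  cvgn (fun n => g_ n x) -> g_ n x @[n --> \oo] --> esup_limit g_ x.
Proof.
move=> /cvg_ex[l gl]; rewrite /esup_limit.
rewrite (cvg_limn_einf_sup (_ : _ --> l%:E))//.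
by apply/cvg_EFin => //; apply: nearW.
Qed.

Lemma summable_increments_cvg (R : realType) (u : nat -> R) (M : R) :
  (forall n, \sum_(0 <= k < n) `|u k.+1 - u k| <= M) -> cvgn u.
Proof.
move=> uM.
have : cvgn [normed series (fun k => u k.+1 - u k)].
  apply: nondecreasing_is_cvgn.
    by apply/nondecreasing_seqP => n; rewrite -subr_ge0 seriesSB; exact:
      normr_ge0.
  by exists M => _ [n _ <-]; exact: uM.
move=> /normed_cvg cu.
have -> : u = fun n => u 0%N + series (fun k => u k.+1 - u k) n.
  by apply/funext => n; rewrite /series /= telescope_sumr// addrC subrK.
by apply: is_cvgD => //; exact: is_cvg_cst.
Qed.

Lemma sum_expr2V (R : realType) (n : nat) :
  \sum_(0 <= k < n) 2^-1 ^+ k = 2 - 2 * 2^-1 ^+ n :> R.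
Proof.
elim: n => [|n ih]; first by rewrite big_geq// expr0; ring.
by rewrite big_nat_recr//= ih exprS; field.
Qed.

(** The integral of the whole series is at most 2 c by monotone convergence, so its sum is finite
    almost everywhere. *)
Lemma summable_tintegral_ae (R : realType) (g_ : nat -> R -> R) (c : R) :
  (forall k, tintegrable (g_ k)) -> (forall k, ae_torus (fun x => 0 <= g_ k x))
    ->
  (forall k, tintegral (g_ k) <= c * 2^-1 ^+ k) ->
  ae_torus (fun x => exists M, forall n, \sum_(0 <= k < n) g_ k x <= M).
Proof.
move=> ig g0 gc.
have mn k : measurable_fun (torus R) (fun x => `|g_ k x|%:E).
  exact: (measurable_int _ (tintegrable_norm (ig k))).
have c0 : 0 <= c.
  have := gc 0%N; rewrite expr0 mulr1; apply: le_trans.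
  exact: tintegral_ge0.
have int_le k : (\int[@lebesgue_measure R]_(x in torus R) `|g_ k x|%:E <=
    (c * 2^-1 ^+ k)%:E)%E.
  rewrite tintegralE; last exact: tintegrable_norm.
  rewrite lee_fin; apply: le_trans (gc k).
  apply: le_tintegral => //; first exact: tintegrable_norm.
  by move: (g0 k); apply: ae_torusS => x h; rewrite ger0_norm.
have fin : (\int[@lebesgue_measure R]_(x in torus R)
    \sum_(0 <= k <oo) `|g_ k x|%:E < +oo)%E.
  rewrite (@integral_nneseries _ _ _ (@lebesgue_measure R))//.
  apply: (@le_lt_trans _ _ (c * 2)%:E); last exact: ltry.
  apply: lime_le.
    by apply: is_cvg_nneseries => n _ _; apply: integral_ge0 => x _; rewrite
      lee_fin.
  apply: nearW => n; apply: (@le_trans _ _ (\sum_(0 <= k < n) (c * 2^-1 ^+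
    k)%:E)%E).
    by apply: lee_sum => k _; exact: int_le.
  rewrite sumEFin lee_fin -mulr_sumr sum_expr2V ler_wpM2l//.
  by have := exprn_ge0 n (_ : 0 <= 2^-1 :> R); rewrite invr_ge0 ler0n => /(_
    isT); lra.
have ms : measurable_fun (torus R) (fun x => \sum_(0 <= k <oo) `|g_ k x|%:E)%E.
  by apply: (ge0_emeasurable_sum (P := xpredT)) => // n x Dx _; rewrite lee_fin.
have isum : (@lebesgue_measure R).-integrable (torus R)
    (fun x => \sum_(0 <= k <oo) `|g_ k x|%:E)%E.
  apply/integrableP; split=> //.
  rewrite [X in (X < _)%E](_ : _ = \int[@lebesgue_measure R]_(x in torus R)
    \sum_(0 <= k <oo) `|g_ k x|%:E)%E//.
  apply: eq_integral => x _; rewrite gee0_abs//.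
  by apply: nneseries_ge0 => n _ _; rewrite lee_fin.
have := integrable_ae (@measurable_torus R) isum.
apply: (@filterS _ _ (ae_filter R)) => x h Dx.
have fx := h Dx.
exists (fine (\sum_(0 <= k <oo) `|g_ k x|%:E)%E) => n.
rewrite -lee_fin fineK// -sumEFin.
apply: (@le_trans _ _ (\sum_(0 <= k < n) `|g_ k x|%:E)%E).
  by apply: lee_sum => k _; rewrite lee_fin ler_norm.
by apply: nneseries_lim_ge => k _ _; rewrite lee_fin.
Qed.

(** Where the weight vanishes, closeness in L_2(f) gives no pointwise convergence; the integrand is
    0 there, whence the alternative [f x = 0]. *)
Lemma wnorm_fatou (R : realType) (f : R -> R) (q h : R -> R[i])
    (p_ : nat -> R -> R[i]) (K_ : nat -> R) (K : R) :
  spectral_density f -> inL2 f q -> (forall n, inL2 f (p_ n)) -> cmeasurable h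
    ->
  ae_torus (fun x => f x = 0 \/
    (complex.Re (p_ n x) @[n --> \oo] --> complex.Re (h x) /\
     complex.Im (p_ n x) @[n --> \oo] --> complex.Im (h x))) ->
  (forall n, wnorm f (fun x => q x - p_ n x) <= K_ n) ->
  K_ n @[n --> \oo] --> K ->
  inL2 f (fun x => q x - h x) /\ wnorm f (fun x => q x - h x) <= K.
Proof.
move=> sf iq ip mh cp pK cK.
have mq : cmeasurable (fun x => q x - h x).
  by apply: cmeasurableB => //; case: iq.
have [] := @tintegral_fatou R (fun n x => nsq (q x - p_ n x) * f x)
  (fun x => nsq (q x - h x) * f x) K_ K _ _ _ _ pK cK => //.
- by move=> n; case: (inL2B sf iq (ip n)).
- by move=> n; exact: nsqM_ge0.
- exact: measurable_nsqM.
- move: cp; apply: ae_torusS => x [->|[cr ci]].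
    by under eq_fun do rewrite mulr0; rewrite mulr0; exact: cvg_cst.
  apply: cvgM; last exact: cvg_cst.
  rewrite /nsq !reim; under eq_fun do rewrite !reim.
  by apply: cvgD; rewrite !expr2; apply: cvgM;
    (apply: cvgB => //; exact: cvg_cst).
Qed.

(** A minimizing sequence is Cauchy by [near_minimizer_dist]; as in the Riesz-Fischer theorem, fast
    convergence makes it converge almost everywhere where f > 0, and Fatou's lemma controls the
    limit. *)
Lemma projection (R : realType) (N : nat) (f : R -> R) (H : R -> R[i]) :
  spectral_density f -> inL2 f H ->
  exists h, L2N N f h /\ forall g, L2N N f g ->
    wnorm f (fun x => H x - h x) <= wnorm f (fun x => H x - g x).
Proof.
move=> sf iH.
pose S := [set wnorm f (fun x => H x - p x) | p in observed_poly N].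
have hS : has_inf S.
  split; first by exists (wnorm f (fun x => H x - 0)); exists (fun=> 0) => //;
    exact: observed_poly0.
  exists 0 => _ [p op <-]; apply: wnorm_ge0 => //.
  by apply: inL2B => //; exact: observed_inL2 op.
pose d := inf S.
have dp p : observed_poly N p -> d <= wnorm f (fun x => H x - p x).
  by move=> op; apply: ge_inf; [case: hS|exists p].
(* The rate 8^-n is chosen so that 2^k e k is still at most 2^-k after the weighting in [g_]
   below. *)
pose e n : R := 2^-1 ^+ (3 * n).
have e0 n : 0 < e n by rewrite exprn_gt0// invr_gt0.
have : forall n, exists p, observed_poly N p /\
    wnorm f (fun x => H x - p x) <= d + e n.
  move=> n; have [_ [p op <-] lt] := inf_adherent (e0 n) hS.
  by exists p; split=> //; exact: ltW.
move=> /choice[p_ p_P].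
have op n : observed_poly N (p_ n) by case: (p_P n).
have pd n : wnorm f (fun x => H x - p_ n x) <= d + e n by case: (p_P n).
have ip n : inL2 f (p_ n) by exact: observed_inL2 (op n).
have pp m n : wnorm f (fun x => p_ m x - p_ n x) <= 2 * (e m + e n).
  exact: near_minimizer_dist (op m) (pd m) (op n) (pd n).
have ie n : e n.+1 = 8^-1 * e n.
  by rewrite /e mulnS exprD; congr (_ * _); field.
pose D k x : R[i] := p_ k.+1 x - p_ k x.
have iD k : inL2 f (D k) by exact: inL2B.
(* By Young's inequality |r| <= 2^k r^2 + 2^-k, so summability of [g_] at a point with f > 0 makes
   the increments of [p_] absolutely summable there, although only their squares are controlled in
   the mean. *)
pose g_ k x := (2 ^+ k * nsq (D k x) + 2^-1 ^+ k) * f x.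
have g_E k : g_ k = fun x => 2 ^+ k * (nsq (D k x) * f x) + 2^-1 ^+ k * f x.
  by apply/funext => x; rewrite /g_ mulrDl mulrA.
have jf : tintegrable f by case: sf.
have ig k : tintegrable (g_ k).
  rewrite g_E; apply: tintegrableD; apply: tintegrableZ => //.
  by case: (iD k).
have e_le k : 2 ^+ k * e k <= 2^-1 ^+ k.
  elim: k => [|k ih]; first by rewrite /e muln0 !expr0 mulr1.
  rewrite ie !exprS; have := exprn_ge0 k (_ : 0 <= 2^-1 :> R).
  by rewrite invr_ge0 ler0n => /(_ isT); move: ih; lra.
have gc k : tintegral (g_ k) <= (4 + tintegral f) * 2^-1 ^+ k.
  rewrite g_E tintegralD; [|by apply: tintegrableZ; case: (iD k)|exact:
    tintegrableZ].
  rewrite !tintegralZ//; last by case: (iD k).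
  rewrite mulrDl [tintegral f * _]mulrC lerD2r.
  have := pp k.+1 k; rewrite ie => h.
  apply: (@le_trans _ _ (2 ^+ k * (4 * e k))).
    rewrite ler_wpM2l ?exprn_ge0//; apply: le_trans h _.
    by have := e0 k; lra.
  by rewrite mulrCA ler_wpM2l.
have g0 k : ae_torus (fun x => 0 <= g_ k x).
  case: sf => f0 _; move: f0; apply: ae_torusS => x f0.
  by rewrite mulr_ge0// addr_ge0 ?mulr_ge0 ?nsq_ge0 ?exprn_ge0 ?invr_ge0.
have young (k : nat) (r s : R) : `|r| <= 2 ^+ k * (r ^+ 2 + s ^+ 2) + 2^-1 ^+ k.
  have a0 : 0 < 2 ^+ k :> R by rewrite exprn_gt0.
  have -> : 2^-1 ^+ k = (2 ^+ k)^-1 :> R by rewrite exprVn.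
  set a := 2 ^+ k in a0 *.
  rewrite -(real_normK (num_real r)).
  have n0 := normr_ge0 r; have s0 := sqr_ge0 s.
  have : 0 <= a^-1 * (a * `|r| - 1) ^+ 2 by rewrite mulr_ge0 ?sqr_ge0//
    invr_ge0 ltW.
  have -> : a^-1 * (a * `|r| - 1) ^+ 2 = a * `|r| ^+ 2 - 2 * `|r| + a^-1.
    by field; rewrite gt_eqF.
  have : 0 <= a * s ^+ 2 by rewrite mulr_ge0// ltW.
  by rewrite mulrDr; lra.
pose h x : R[i] := esup_limit (fun n x => complex.Re (p_ n x)) x +i*
  esup_limit (fun n x => complex.Im (p_ n x)) x.
have mh : cmeasurable h.
  by split; apply: measurable_esup_limit => n; case: (ip n) => -[].
have cvgp : ae_torus (fun x => f x = 0 \/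
    (complex.Re (p_ n x) @[n --> \oo] --> complex.Re (h x) /\
     complex.Im (p_ n x) @[n --> \oo] --> complex.Im (h x))).
  have := summable_tintegral_ae ig g0 gc.
  case: sf => f0 _; move: f0; apply: ae_torusS2 => x.
  rewrite le_eqVlt => /predU1P[<-|fx0 [M gM]]; [by left|right].
  have bound (u : nat -> R) : (forall k, `|u k.+1 - u k| <=
      2 ^+ k * nsq (D k x) + 2^-1 ^+ k) -> cvgn u.
    move=> uD; apply: (@summable_increments_cvg _ _ (M / f x)) => n.
    rewrite ler_pdivlMr//; apply: le_trans (gM n).
    by rewrite mulr_suml; apply: ler_sum => k _; rewrite ler_wpM2r// ltW.
  split; apply: esup_limit_cvg; apply: bound => k.
  - have -> : complex.Re (p_ k.+1 x) - complex.Re (p_ k x) = complex.Re (D k x).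
      by rewrite /D !reim.
    exact: young.
  - have -> : complex.Im (p_ k.+1 x) - complex.Im (p_ k x) = complex.Im (D k x).
      by rewrite /D !reim.
    by rewrite /nsq [_ ^+ 2 + _]addrC; exact: young.
have ce : e n @[n --> \oo] --> (0 : R).
  have -> : e = fun n => (2^-1 ^+ 3) ^+ n by apply/funext => n; rewrite /e
    exprM.
  apply: cvg_expr; rewrite ger0_norm ?exprn_ge0 ?invr_ge0//.
  by rewrite exprn_ilt1 ?invr_ge0// invf_lt1// ltr1n.
have [iHh Hh] : inL2 f (fun x => H x - h x) /\ wnorm f (fun x => H x - h x) <=
  d.
  apply: (wnorm_fatou sf iH ip mh cvgp pd).
  by rewrite -[X in _ --> X]addr0; apply: cvgD => //; exact: cvg_cst.
have ih : inL2 f h.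
  have := inL2B sf iH iHh.
  by under eq_fun do rewrite subKr.
exists h; split.
  apply/L2NP => //; split=> // eps eps0.
  have [n en] : exists n, 2 * e n < eps.
    have /cvgrPdist_lt/(_ (eps / 2))[|n _ /(_ n (leqnn _))] := ce.
      by rewrite divr_gt0.
    by rewrite sub0r normrN gtr0_norm// => en; exists n; lra.
  exists (p_ n); split=> //; apply: le_lt_trans en.
  (* Fatou's lemma in the second index of [pp], the first being fixed at [n]. *)
  have [_] : inL2 f (fun x => p_ n x - h x) /\
      wnorm f (fun x => p_ n x - h x) <= 2 * e n.
    apply: (wnorm_fatou sf (ip n) ip mh cvgp (pp n)).
    have -> : 2 * e n = 2 * (e n + 0) by rewrite addr0.
    apply: cvgM; first exact: cvg_cst.
    by apply: cvgD => //; exact: cvg_cst.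
  congr (_ <= _); congr tintegral; apply/funext => x.
  by rewrite -nsqN opprB.
by move=> g Lg; apply: le_trans Hh _; exact: L2N_lower_bound Lg.
Qed.

(** * Fourier coefficients *)

Definition fcoef (R : realType) (h : R -> R[i]) (k : int) : R[i] :=
  cintegral (fun x => h x * expi ((- k)%:~R * x)).

Lemma fcoef_expi (R : realType) (j k : int) :
  fcoef (fun x : R => expi (j%:~R * x)) k =
  (if j == k then 2 * pi else 0 : R)%:C.
Proof.
rewrite /fcoef; under eq_fun do rewrite -expiD -mulrDl -intrD.
by rewrite cintegral_expi subr_eq0.
Qed.

Lemma fcoefD (R : realType) (g h : R -> R[i]) (k : int) :
  ctintegrable g -> ctintegrable h ->
  fcoef (fun x => g x + h x) k = fcoef g k + fcoef h k.
Proof.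
move=> ig ih; rewrite /fcoef; under eq_fun do rewrite mulrDl.
by rewrite cintegralD//; exact: ctintegrableM_expi.
Qed.

Lemma fcoefZ (R : realType) (c : R[i]) (h : R -> R[i]) (k : int) :
  ctintegrable h -> fcoef (fun x => c * h x) k = c * fcoef h k.
Proof.
move=> ih; rewrite /fcoef; under eq_fun do rewrite -mulrA.
by rewrite cintegralZ//; exact: ctintegrableM_expi.
Qed.

Lemma fcoefB (R : realType) (g h : R -> R[i]) (k : int) :
  ctintegrable g -> ctintegrable h ->
  fcoef (fun x => g x - h x) k = fcoef g k - fcoef h k.
Proof.
move=> ig ih; under eq_fun do rewrite -[- h _]mulN1r.
by rewrite fcoefD ?fcoefZ ?mulN1r//; exact: ctintegrableZ.
Qed.

Lemma ctintegrable_trigp (R : realType) (l : seq (int * R[i])) :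
  ctintegrable (trigp l).
Proof. by apply: ctintegrable_sum => q; apply: ctintegrableZ; exact:
  ctintegrable_expi. Qed.

Lemma fcoef_trigp (R : realType) (l : seq (int * R[i])) (k : int) :
  fcoef (trigp l) k = (2 * pi)%:C * \sum_(q <- l | q.1 == k) q.2.
Proof.
rewrite /fcoef /trigp; under eq_fun do rewrite mulr_suml.
rewrite cintegral_sum; last first.
  by move=> q; apply: ctintegrableM_expi; apply: ctintegrableZ; exact:
    ctintegrable_expi.
rewrite mulr_sumr [RHS]big_mkcond/=; apply: eq_bigr => q _.
rewrite -/(fcoef (fun x => q.2 * expi (q.1%:~R * x)) k) fcoefZ; last exact:
  ctintegrable_expi.
by rewrite fcoef_expi; case: ifP; rewrite ?mulr0// mulrC.
Qed.

Lemma fcoef_observed (R : realType) (N : nat) (p : R -> R[i]) (k : int) :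
  observed_poly N p -> 0 <= k <= N%:Z -> fcoef p k = 0.
Proof.
move=> /observed_polyP[l [lN ->]] kN; rewrite fcoef_trigp big_seq_cond big1
  ?mulr0//.
by move=> q /andP[/(allP lN)] /negP qN /eqP qk; case: qN; rewrite qk.
Qed.

Lemma fcoef_trig_poly (R : realType) (N : nat) (c : 'cV[R[i]]_N.+1)
    (k : 'I_N.+1) : fcoef (trig_poly c) k%:Z = (2 * pi)%:C * c k 0.
Proof.
rewrite trig_polyE fcoef_trigp big_map /=; congr (_ * _).
by under eq_bigl do rewrite eqz_nat; rewrite big_pred1_eq.
Qed.

Lemma cintegralM_trigp_eq0 (R : realType) (w : R -> R[i])
    (l : seq (int * R[i])) : ctintegrable w -> (forall k, fcoef w k = 0) ->
  cintegral (fun x => w x * trigp l x) = 0.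
Proof.
move=> iw w0; rewrite /trigp; under eq_fun do rewrite mulr_sumr.
rewrite cintegral_sum => [|q].
  apply: big1 => q _; under eq_fun do rewrite mulrCA.
  rewrite cintegralZ; last exact: ctintegrableM_expi.
  by have := w0 (- q.1); rewrite /fcoef opprK => ->; rewrite mulr0.
under eq_fun do rewrite mulrCA.
by apply: ctintegrableZ; exact: ctintegrableM_expi.
Qed.

(** * Uniqueness of Fourier coefficients of integrable functions *)

(** Dominated convergence with majorant |w|: Fatou's lemma for the nonnegative functions |w| - s w
    q_n, with s = 1 and s = -1, gives both inequalities. *)
Lemma tintegral_unit_dominated_eq0 (R : realType) (w q : R -> R)
    (q_ : nat -> R -> R) :
  tintegrable w -> measurable_fun (torus R) q ->
  (forall n, measurable_fun (torus R) (q_ n)) ->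
  (forall n, ae_torus (fun x => 0 <= q_ n x <= 1)) ->
  ae_torus (fun x => q_ n x @[n --> \oo] --> q x) ->
  ae_torus (fun x => 0 <= q x <= 1) ->
  (forall n, tintegral (fun x => w x * q_ n x) = 0) ->
  tintegral (fun x => w x * q x) = 0.
Proof.
move=> iw mq mq_ q_1 cq q1 wq0.
have unit_norm (r : R) : 0 <= r <= 1 -> `|r| <= 1.
  by move=> /andP[r0 r1]; rewrite ger0_norm.
have iwq : tintegrable (fun x => w x * q x).
  apply: (@tintegrableM_bounded _ _ _ 1) => //.
  by move: q1; apply: ae_torusS => x; exact: unit_norm.
have iwq_ n : tintegrable (fun x => w x * q_ n x).
  apply: (@tintegrableM_bounded _ _ _ 1) => //.
  by move: (q_1 n); apply: ae_torusS => x; exact: unit_norm.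
have inw : tintegrable (fun x => `|w x|) by exact: tintegrable_norm.
have main (s : R) : `|s| = 1 -> 0 <= s * tintegral (fun x => w x * q x).
  move=> s1.
  have [] := @tintegral_fatou R (fun n x => `|w x| - s * (w x * q_ n x))
    (fun x => `|w x| - s * (w x * q x)) (fun=> tintegral (fun x => `|w x|))
    (tintegral (fun x => `|w x|)).
  - by move=> n; apply: tintegrableB => //; exact: tintegrableZ.
  - move=> n; move: (q_1 n); apply: ae_torusS => x h.
    rewrite subr_ge0 (le_trans (ler_norm _))// !normrM s1 mul1r.
    by rewrite -[leRHS]mulr1 ler_wpM2l// unit_norm.
  - by apply: tintegrable_measurable; apply: tintegrableB => //; exact:
    tintegrableZ.
  - move: cq; apply: ae_torusS => x cx; apply: cvgB; first exact: cvg_cst.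
    by apply: cvgM; [exact: cvg_cst|apply: cvgM => //; exact: cvg_cst].
  - move=> n; rewrite tintegralB//; last exact: tintegrableZ.
    by rewrite tintegralZ// wq0 mulr0 subr0.
  - exact: cvg_cst.
  move=> _; rewrite tintegralB//; last exact: tintegrableZ.
  by rewrite tintegralZ//; lra.
apply/eqP; rewrite eq_le; apply/andP; split.
- by have := main (-1); rewrite normrN normr1 => /(_ erefl); lra.
- by have := main 1; rewrite normr1 => /(_ erefl); lra.
Qed.

Lemma bernoulli_inequality (R : realType) (u : R) (k : nat) : -1 <= u ->
  1 + k%:R * u <= (1 + u) ^+ k.
Proof.
move=> u1; elim: k => [|k ih]; first by rewrite mul0r addr0 expr0.
rewrite exprS; apply: (@le_trans _ _ ((1 + u) * (1 + k%:R * u))).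
  rewrite -natr1; have : 0 <= k%:R * u ^+ 2 by rewrite mulr_ge0 ?sqr_ge0.
  by rewrite expr2; lra.
by rewrite ler_wpM2l//; lra.
Qed.

(* By Bernoulli's inequality this tends to 1 for 0 <= y < 1/2 and to 0 for
   1/2 < y <= 1: polynomials in y approximate a step. *)
Definition step_poly (R : realType) (y : R) (n : nat) : R := (1 - y ^+ n) ^+ (2
  ^ n).

Lemma step_poly_unit (R : realType) (y : R) (n : nat) :
  0 <= y <= 1 -> 0 <= step_poly y n <= 1.
Proof.
move=> /andP[y0 y1]; have := exprn_ge0 n y0; have := exprn_ile1 n y0 y1 => h1
  h0.
by rewrite exprn_ge0 ?exprn_ile1 ?subr_ge0// lerBlDr lerDl.
Qed.

Lemma step_poly_cvg1 (R : realType) (y : R) : 0 <= y < 2^-1 ->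
  step_poly y n @[n --> \oo] --> (1 : R).
Proof.
move=> /andP[y0 y1].
apply: (@squeeze_cvgr _ _ _ _ (fun n => 1 - (2 * y) ^+ n) (fun=> 1)).
- apply: nearW => n.
  have /andP[_ ->] : 0 <= step_poly y n <= 1 by apply: step_poly_unit; lra.
  have yn : y ^+ n <= 1 by rewrite exprn_ile1//; lra.
  have := @bernoulli_inequality _ (- y ^+ n) (2 ^ n); rewrite lerN2 => /(_ yn).
  by rewrite andbT exprMn natrX mulrN.
- rewrite -[X in _ --> X]subr0; apply: cvgB; first exact: cvg_cst.
  by apply: cvg_expr; rewrite ger0_norm; lra.
- exact: cvg_cst.
Qed.

(** Multiply by (1 + y^n)^(2^n), which is at least (2 y)^n by Bernoulli: the product is (1 -
    y^(2n))^(2^n), at most 1, so the step polynomial is at most (2 y)^-n. *)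
Lemma step_poly_cvg0 (R : realType) (y : R) : 2^-1 < y <= 1 ->
  step_poly y n @[n --> \oo] --> (0 : R).
Proof.
move=> /andP[y0 y1].
apply: (@squeeze_cvgr _ _ _ _ (fun=> 0) (fun n => (2 * y)^-1 ^+ n)).
- apply: nearW => n.
  have /andP[-> _] : 0 <= step_poly y n <= 1 by apply: step_poly_unit; lra.
  have yn0 : 0 <= y ^+ n by rewrite exprn_ge0//; lra.
  have yn : y ^+ n <= 1 by rewrite exprn_ile1//; lra.
  have p0 : 0 < (2 * y) ^+ n by rewrite exprn_gt0//; lra.
  rewrite exprVn -div1r ler_pdivlMr//=.
  apply: (@le_trans _ _ (step_poly y n * (1 + y ^+ n) ^+ (2 ^ n))).
    rewrite ler_wpM2l//; last first.
      have h : -1 <= y ^+ n by apply: le_trans yn0; rewrite oppr_le0 ler01.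
      have := bernoulli_inequality (2 ^ n) h; rewrite natrX -exprMn.
      by apply: le_trans; rewrite lerDr ler01.
    by have /andP[] : 0 <= step_poly y n <= 1 by apply: step_poly_unit; lra.
  rewrite -exprMn exprn_ile1//.
    by rewrite mulr_ge0//; lra.
  by have := sqr_ge0 (y ^+ n); rewrite expr2; lra.
- exact: cvg_cst.
- apply: cvg_expr; rewrite ger0_norm ?invr_ge0; last by lra.
  by rewrite invf_lt1; lra.
Qed.

Definition real_trigp (R : realType) (q : R -> R) : Prop :=
  exists l, forall x, (q x)%:C = trigp l x.

Lemma real_trigp_cst (R : realType) (c : R) : real_trigp (fun _ : R => c).
Proof.
by exists [:: (0, c%:C)] => x; rewrite /trigp big_seq1 /= mul0r expi0 mulr1.
Qed.

Lemma real_trigpD (R : realType) (q r : R -> R) :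
  real_trigp q -> real_trigp r -> real_trigp (fun x => q x + r x).
Proof.
move=> [l lq] [m mr]; exists (l ++ m) => x.
by rewrite /trigp big_cat/= -/(trigp l x) -/(trigp m x) -lq -mr rmorphD.
Qed.

Lemma real_trigpM (R : realType) (q r : R -> R) :
  real_trigp q -> real_trigp r -> real_trigp (fun x => q x * r x).
Proof.
move=> [l lq] [m mr].
exists [seq (a.1 + b.1, a.2 * b.2) | a <- l, b <- m] => x.
rewrite rmorphM /= lq mr /trigp big_allpairs_dep/= mulr_suml.
apply: eq_bigr => a _; rewrite mulr_sumr; apply: eq_bigr => b _ /=.
by rewrite intrD mulrDl expiD; ring.
Qed.

Lemma real_trigpX (R : realType) (q : R -> R) (n : nat) :
  real_trigp q -> real_trigp (fun x => q x ^+ n).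
Proof.
move=> tq; elim: n => [|n ih].
  by under eq_fun do rewrite expr0; exact: real_trigp_cst.
by under eq_fun do rewrite exprS; exact: real_trigpM.
Qed.

Lemma real_trigp_cos (R : realType) : real_trigp (@cos R).
Proof.
exists [:: (1, 2^-1%:C); (-1, 2^-1%:C)] => x.
rewrite /trigp big_cons big_seq1 /= mul1r mulN1r.
by apply: complex_eq; rewrite !reim /= ?cosN ?sinN; field.
Qed.

Lemma real_trigp_sin (R : realType) : real_trigp (@sin R).
Proof.
exists [:: (1, 0 -i* 2^-1); (-1, 0 +i* 2^-1)] => x.
rewrite /trigp big_cons big_seq1 /= mul1r mulN1r.
by apply: complex_eq; rewrite !reim /= ?cosN ?sinN; field.
Qed.

Lemma measurable_real_trigp (R : realType) (q : R -> R) :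
  real_trigp q -> measurable_fun (torus R) q.
Proof.
move=> [l lq]; have [ml _] := cmeasurable_trigp l.
have -> // : q = fun x => complex.Re (trigp l x).
by apply/funext => x; rewrite -lq.
Qed.

(* On the torus this function is below 1/2 on the ray x > c and above it on
   x < c, since 2 sin a sin b = cos (a - b) - cos (a + b). *)
Definition ray_fun (R : realType) (c x : R) : R :=
  2^-1 - sin ((x - c) / 2) * sin ((pi - x) / 2) / 2.

(** The sine of a half-angle has no integer frequency, but the product of two has. The second factor
    sin ((pi - x) / 2) is positive inside the torus, so it restores integer frequencies and keeps
    the single sign change at [c]. *)
Lemma real_trigp_ray (R : realType) (c : R) : real_trigp (ray_fun c).
Proof.
have -> : ray_fun c = fun x => (2^-1 + cos ((pi - c) / 2) / 4) +
    (- cos ((c + pi) / 2) / 4 * cos x + - sin ((c + pi) / 2) / 4 * sin x).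
  apply/funext => x; rewrite /ray_fun.
  set a := (x - c) / 2; set b := (pi - x) / 2.
  have h1 : (pi - c) / 2 = a + b by rewrite /a /b; field.
  have h2 : cos (a - b) = cos x * cos ((c + pi) / 2) + sin x * sin ((c + pi) /
    2).
    by rewrite -cosB; congr cos; rewrite /a /b; field.
  rewrite h1 cosD; move: h2; rewrite cosB; lra.
apply: real_trigpD; first exact: real_trigp_cst.
by apply: real_trigpD; apply: real_trigpM; first [exact: real_trigp_cst
  |exact: real_trigp_cos|exact: real_trigp_sin].
Qed.

Lemma ray_fun_unit (R : realType) (c x : R) : 0 <= ray_fun c x <= 1.
Proof.
rewrite /ray_fun; set a := (x - c) / 2; set b := (pi - x) / 2.
have : `|sin a * sin b| <= 1.
  rewrite normrM -[leRHS]mulr1 ler_pM// ler_norml ?sin_le1 ?sin_geN1//.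
by rewrite ler_norml; lra.
Qed.

Lemma ray_fun_gt (R : realType) (c x : R) : - pi <= c <= pi -> - pi < x < pi ->
  c < x -> ray_fun c x < 2^-1.
Proof.
move=> c1 x1 cx; rewrite /ray_fun.
have : 0 < sin ((x - c) / 2) * sin ((pi - x) / 2).
  by rewrite mulr_gt0// sin_gt0_pi//; apply/andP; split; lra.
by lra.
Qed.

Lemma ray_fun_lt (R : realType) (c x : R) : - pi <= c <= pi -> - pi < x < pi ->
  x < c -> 2^-1 < ray_fun c x.
Proof.
move=> c1 x1 cx; rewrite /ray_fun.
have : 0 < sin ((c - x) / 2) * sin ((pi - x) / 2).
  by rewrite mulr_gt0// sin_gt0_pi//; apply/andP; split; lra.
have -> : (c - x) / 2 = - ((x - c) / 2) by field.
by rewrite sinN; lra.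
Qed.

Lemma ae_torus_neq (R : realType) (c : R) : ae_torus (fun x => x != c).
Proof.
exists [set c]; split; first exact: measurable_set1.
  exact: lebesgue_measure_set1.
by move=> x /= h; apply: contrapT => /eqP xc; apply: h.
Qed.

Lemma ae_torus_interior (R : realType) : ae_torus (fun x : R => - pi < x < pi).
Proof.
move: (ae_torus_neq (- pi : R)) (ae_torus_neq (pi : R)).
apply: (@filterS2 _ _ (ae_filter R)).
move=> x h1 h2 Dx; move: (Dx); rewrite /torus /= in_itv /= => /andP[a b].
by rewrite !lt_neqAle a b eq_sym h1// h2.
Qed.

(** The step polynomials of [ray_fun c] tend to 1 on x > c and to 0 on x < c, so the integral over x
    > c vanishes; the constant multiplier 1 shows that the total integral does too, and the
    difference is the ray x <= c. *)
Lemma ray_tintegral_eq0 (R : realType) (w : R -> R) : tintegrable w ->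
  (forall q, real_trigp q -> tintegral (fun x => w x * q x) = 0) ->
  forall c, - pi <= c <= pi -> tintegral (fun x => w x * (x <= c)%R%:R) = 0.
Proof.
move=> iw wq c cpi.
have mray : measurable_fun (torus R) (fun x : R => (x <= c)%R%:R : R).
  rewrite (_ : (fun _ => _) = \1_(`]-oo, c]%classic : set R)).
    exact: measurable_indic.
  by apply/funext => x; rewrite indicE mem_setE in_itv.
have t1 : tintegral (fun x => w x * (1 - (x <= c)%R%:R)) = 0.
  apply: (@tintegral_unit_dominated_eq0 _ _ _
    (fun n x => step_poly (ray_fun c x) n)) => //.
  - by apply: measurable_funB.
  - move=> n; apply: measurable_real_trigp.
    apply: (real_trigpX (q := fun x => 1 - ray_fun c x ^+ n)).
    under eq_fun do rewrite -mulN1r.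
    apply: real_trigpD; first exact: real_trigp_cst.
    apply: real_trigpM; first exact: real_trigp_cst.
    by apply: real_trigpX; exact: real_trigp_ray.
  - by move=> n; apply: ae_torusW => x; apply: step_poly_unit; exact:
    ray_fun_unit.
  - move: (ae_torus_neq c) (@ae_torus_interior R); apply: ae_torusS2 => x xc x1.
    have /andP[r0 r1] := ray_fun_unit c x.
    case: (ltgtP x c) xc => // [xc|cx] _ /=.
    + by rewrite subrr; apply: step_poly_cvg0; rewrite r1 ray_fun_lt.
    + by rewrite subr0; apply: step_poly_cvg1; rewrite r0 ray_fun_gt.
  - by apply: ae_torusW => x; case: (x <= c)%R; rewrite ?subrr ?subr0 lexx
    ler01.
  - move=> n; apply: wq; apply: (real_trigpX (q := fun x => 1 - ray_fun c x ^+
    n)).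
    under eq_fun do rewrite -mulN1r.
    apply: real_trigpD; first exact: real_trigp_cst.
    apply: real_trigpM; first exact: real_trigp_cst.
    by apply: real_trigpX; exact: real_trigp_ray.
have t2 : tintegral w = 0.
  have := wq _ (real_trigp_cst 1).
  by under eq_fun do rewrite mulr1.
have iwr : tintegrable (fun x => w x * (x <= c)%R%:R).
  apply: (@tintegrableM_bounded _ _ _ 1) => //.
  by apply: ae_torusW => x; case: (x <= c)%R; rewrite ?normr1 ?normr0.
move: t1; under eq_fun do rewrite mulrBr mulr1.
by rewrite tintegralB// t2 sub0r => /eqP; rewrite oppr_eq0 => /eqP.
Qed.

(** The indefinite integral of [w], extended by 0 off the torus, is identically 0, and almost
    everywhere its derivative is [w]. *)
Lemma rays_eq0_ae (R : realType) (w : R -> R) : tintegrable w ->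
  (forall c, - pi <= c <= pi -> tintegral (fun x => w x * (x <= c)%R%:R) = 0) ->
  ae_torus (fun x => w x = 0).
Proof.
move=> iw wc.
pose g : R -> R := w \_ (torus R).
have ig : (@lebesgue_measure R).-integrable setT (EFin \o g).
  have -> : EFin \o g = (EFin \o w) \_ (torus R).
    by apply/funext => x; rewrite /g /patch /=; case: ifP.
  exact/(@integrable_mkcond _ _ _ (@lebesgue_measure R) _ (EFin \o w)
    (@measurable_torus R)).
have lg : locally_integrable setT g.
  by apply: integrable_locally_restrict => //; exact: measurable_itv.
have F0 x :
    \int[@lebesgue_measure R]_(t in [set` Interval (BLeft (- pi)) (BRight x)])
      g t = 0.
  have [xpi|pix] := ltP x (- pi).
    by rewrite set_itv_ge ?Rintegral_set0// bnd_simp -ltNge.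
  have pi0 := pi_gt0 R.
  (* Beyond pi the extended function is 0, so the ray can be cut at pi, where the hypothesis
     applies. *)
  have := wc (Num.min x pi); rewrite ge_min le_min pix lexx orbT => /(_ _) cx.
  have {}cx := cx (_ : (- pi <= pi) && true).
  rewrite Rintegral_mkcond -[RHS]cx; last by rewrite andbT; lra.
  rewrite /tintegral [RHS]Rintegral_mkcond; congr Rintegral.
  apply/funext => t; rewrite /g /patch /torus !mem_setE !in_itv /= le_min.
  case: (boolP (- pi <= t)) => //= _.
  by case: (t <= x)%R; case: (t <= pi)%R; rewrite /= ?mulr1 ?mulr0.
have FE : (fun x => \int[@lebesgue_measure R]_(t in
    [set` Interval (BLeft (- pi)) (BRight x)]) g t) = cst 0.
  by apply/funext => x; exact: F0.
have igy y : (@lebesgue_measure R).-integrable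
    [set` Interval (BLeft (- pi)) (BRight y)] (EFin \o g).
  by apply: integrableS ig => //; exact: measurable_itv.
have := @FTC1 R g (BLeft (- pi)) igy lg; cbv zeta; rewrite FE.
move: (@ae_torus_interior R).
apply: (@filterS2 _ _ (ae_filter R)).
move=> x xpi Fx Dx; have /andP[x1 _] := xpi Dx.
have [|_] := Fx; first by rewrite /= lte_fin.
by rewrite derive1_cst /g /patch mem_set.
Qed.

(** Against a real multiplier the integrals of the real and imaginary parts of [w] separate, so each
    part falls under the real case. *)
Lemma fourier_complete (R : realType) (w : R -> R[i]) : ctintegrable w ->
  (forall k, fcoef w k = 0) -> ae_torus (fun x => w x = 0).
Proof.
move=> iw w0; have [iwr iwi] := iw.
have wq q : real_trigp q ->
    tintegral (fun x => complex.Re (w x) * q x) = 0 /\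
    tintegral (fun x => complex.Im (w x) * q x) = 0.
  move=> [l lq]; have := cintegralM_trigp_eq0 l iw w0.
  rewrite cintegralE => -[Er Ei].
  split; [rewrite -[RHS]Er|rewrite -[RHS]Ei]; congr tintegral; apply/funext =>
    x.
  - by rewrite -lq reim /= mulr0 subr0.
  - by rewrite -lq reim /= mulr0 add0r.
have wr := rays_eq0_ae iwr (ray_tintegral_eq0 iwr (fun q hq => (wq q hq).1)).
have wi := rays_eq0_ae iwi (ray_tintegral_eq0 iwi (fun q hq => (wq q hq).2)).
by move: wr wi; apply: ae_torusS2 => x a b; exact: complex_eq.
Qed.

(** * Membership in the observed subspace from vanishing coefficients *)

Lemma spectral_density1 (R : realType) : spectral_density (fun _ : R => 1).
Proof. by split; [exact: ae_torusW|exact: tintegrable_cst]. Qed.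

Lemma inL2_ctintegrable (R : realType) (h : R -> R[i]) :
  inL2 (fun=> 1) h -> ctintegrable h.
Proof.
move=> [[mr mi]]; under eq_fun do rewrite mulr1.
move=> ih; have i1 := tintegrableD (tintegrable_cst 1) ih.
split; apply: le_tintegrable i1 => //; apply: ae_torusW => x.
- exact: normr_Re_le.
- exact: normr_Im_le.
Qed.

(** Pythagoras: the function subtracted is the orthogonal projection of [u] on the k-th
    exponential. *)
Lemma wnorm_sub_fcoef (R : realType) (u : R -> R[i]) (k : int) : inL2 (fun=> 1)
  u ->
  wnorm (fun=> 1) (fun x =>
    u x - ((2 * pi)^-1)%:C * fcoef u k * expi (k%:~R * x)) =
  wnorm (fun=> 1) u - (2 * pi)^-1 * nsq (fcoef u k).
Proof.
move=> iu; have [mu] := iu; under eq_fun do rewrite mulr1.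
move=> in_u; have pi0 := pi_gt0 R.
set Z := fcoef u k; set c := (2 * pi)^-1.
have iue : ctintegrable (fun x => conjc Z * (u x * expi ((- k)%:~R * x))).
  by apply: ctintegrableZ; apply: ctintegrableM_expi; exact: inL2_ctintegrable.
have int_ue : tintegral (fun x =>
    complex.Re (conjc Z * (u x * expi ((- k)%:~R * x)))) = nsq Z.
  have : cintegral (fun x => conjc Z * (u x * expi ((- k)%:~R * x))) = conjc Z
    * Z.
    rewrite cintegralZ//; apply: ctintegrableM_expi; exact: inL2_ctintegrable.
  move=> E; transitivity (complex.Re (conjc Z * Z)); first by rewrite -E.
  by rewrite /nsq !reim; ring.
rewrite /wnorm; under [X in _ = tintegral X - _]eq_fun do rewrite mulr1.
have -> : (fun x => nsq (u x - c%:C * Z * expi (k%:~R * x)) * 1) =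
    (fun x => (nsq (u x) + c ^+ 2 * nsq Z) -
      2 * c * complex.Re (conjc Z * (u x * expi ((- k)%:~R * x)))).
  (* The two sides differ by a multiple of |e|^2 - 1; isolating that factor leaves a polynomial
     identity. *)
  have key (z v e : R[i]) : nsq e = 1 -> nsq (v - c%:C * z * e) * 1 =
      nsq v + c ^+ 2 * nsq z - 2 * c * complex.Re (conjc z * (v * conjc e)).
    move=> e1; apply/eqP; rewrite -subr_eq0; apply/eqP.
    transitivity (c ^+ 2 * nsq z * (nsq e - 1)); last by rewrite e1; ring.
    by rewrite /nsq !reim /=; ring.
  apply/funext => x.
  have -> : (- k)%:~R * x = - (k%:~R * x) by rewrite mulrNz mulNr.
  by rewrite -conj_expi; apply: key; exact: nsq_expi.
have [iRe _] := iue.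
rewrite tintegralB; last 2 first.
- by apply: tintegrableD => //; exact: tintegrable_cst.
- exact: tintegrableZ.
rewrite tintegralD//; last exact: tintegrable_cst.
have cpi : c * (2 * pi) = 1 by rewrite mulVf// gt_eqF// mulr_gt0.
rewrite tintegral_cst tintegralZ// int_ue.
have -> : c ^+ 2 * nsq Z * (2 * pi) = c * nsq Z * (c * (2 * pi)) by ring.
by rewrite cpi; ring.
Qed.

(** Bessel's inequality for one exponential; it makes coefficients continuous in L_2, so that they
    stay 0 on the closure of the observed polynomials. *)
Lemma fcoef_le_wnorm (R : realType) (u : R -> R[i]) (k : int) :
  inL2 (fun=> 1) u -> nsq (fcoef u k) <= 2 * pi * wnorm (fun=> 1) u.
Proof.
move=> iu; have pi0 := pi_gt0 R.
have := wnorm_sub_fcoef k iu; set b := wnorm _ (fun x => _) => bE.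
have : 0 <= b.
  apply: wnorm_ge0; first exact: spectral_density1.
  apply: inL2B => //; first exact: spectral_density1.
  apply: inL2Z; first exact: spectral_density1.
  apply: (@bounded_inL2 _ _ _ 1); first exact: spectral_density1.
    exact: cmeasurable_expi.
  by apply: ae_torusW => x; rewrite nsq_expi.
rewrite bE subr_ge0 mulrC ler_pdivrMr ?mulr_gt0//.
by rewrite mulrC.
Qed.

Lemma fcoef_L2N (R : realType) (N : nat) (h : R -> R[i]) (k : int) :
  L2N N (fun=> 1) h -> 0 <= k <= N%:Z -> fcoef h k = 0.
Proof.
move=> /(L2NP _ _ (spectral_density1 R))[ih ah] kN.
have pi0 := pi_gt0 R.
apply: nsq_eq0; apply/eqP; rewrite eq_le nsq_ge0 andbT.
apply/ler_addgt0Pr => e e0; rewrite add0r.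
have pi2 : 0 < 2 * pi :> R by rewrite mulr_gt0.
have [p [op pe]] := ah (e / (2 * pi)) (divr_gt0 e0 pi2).
have ip := observed_inL2 (spectral_density1 R) op.
have ihp := inL2B (spectral_density1 R) ih ip.
have := fcoef_le_wnorm k ihp.
rewrite fcoefB; [|exact: inL2_ctintegrable..].
rewrite (fcoef_observed op kN) subr0 => /le_trans; apply.
by move: pe; rewrite ltr_pdivlMr ?mulr_gt0// mulrC => /ltW.
Qed.

Lemma L2N_addP (R : realType) (N : nat) (f : R -> R) (h p : R -> R[i]) :
  spectral_density f -> L2N N f h -> observed_poly N p ->
  L2N N f (fun x => h x + p x).
Proof.
move=> sf /(L2NP _ _ sf)[ih ah] op; apply/L2NP => //; split.
  by apply: inL2D => //; exact: observed_inL2 op.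
move=> e e0; have [q [oq qe]] := ah e e0.
exists (fun x => q x + p x); split; first exact: observed_polyD.
by under eq_fun do rewrite opprD addrACA subrr addr0.
Qed.

Lemma vanishing_fcoef_L2N1 (R : realType) (N : nat) (H : R -> R[i]) :
  inL2 (fun=> 1) H -> (forall k : 'I_N.+1, fcoef H k%:Z = 0) ->
  L2N N (fun=> 1) H.
Proof.
move=> iH H0; have sf := spectral_density1 R; have pi0 := pi_gt0 R.
have [h [Lh hmin]] := projection N sf iH.
have /(L2NP _ _ sf)[ih ah] := Lh.
have iw := inL2B sf iH ih.
have w0 k : fcoef (fun x => H x - h x) k = 0.
  have [kN|kN] := boolP (0 <= k <= N%:Z).
    rewrite fcoefB; [|exact: inL2_ctintegrable..].
    rewrite (fcoef_L2N Lh kN) subr0.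
    case/andP: kN; case: k => // k _; rewrite lez_nat -ltnS => kN.
    exact: (H0 (Ordinal kN)).
  (* For [k] outside 0..N, adding to [h] the k-th harmonic of the residual stays in the subspace and
     lowers the squared norm by |Z|^2 / (2 pi); minimality of [h] forces Z = 0. *)
  apply: nsq_eq0; apply/eqP; rewrite eq_le nsq_ge0 andbT.
  have := wnorm_sub_fcoef k iw; set Z := fcoef _ k.
  have := hmin _ (L2N_addP sf Lh (observed_polyZ (((2 * pi)^-1)%:C * Z)
    (observed_expi R kN))).
  have -> : (fun x => H x - (h x + ((2 * pi)^-1)%:C * Z * expi (k%:~R * x))) =
      fun x => H x - h x - ((2 * pi)^-1)%:C * Z * expi (k%:~R * x).
    by apply/funext => x; rewrite opprD addrA.
  move=> + E; rewrite E.
  by rewrite lerBrDr gerDl pmulr_rle0// invr_gt0 mulr_gt0.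
have Hh := fourier_complete (inL2_ctintegrable iw) w0.
apply/L2NP => //; split=> // e e0; have [p [op pe]] := ah e e0.
exists p; split=> //; apply: le_lt_trans pe.
have ip := observed_inL2 sf op.
apply: le_tintegral; [by case: (inL2B sf iH ip)|by case: (inL2B sf ih ip)|].
by move: Hh; apply: ae_torusS => x /eqP; rewrite subr_eq0 => /eqP ->.
Qed.

(** The polynomials approximating [H] for the weight 1 also do so for [f], whose squared norm is at
    most |K| + 1 times larger; this constant is positive whatever the sign of [K]. *)
Lemma bounded_vanishing_L2N (R : realType) (N : nat) (f : R -> R)
    (H : R -> R[i]) (M K : R) :
  spectral_density f -> ae_torus (fun x => f x <= K) ->
  cmeasurable H -> ae_torus (fun x => nsq (H x) <= M) ->
  (forall k : 'I_N.+1, fcoef H k%:Z = 0) -> L2N N f H.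
Proof.
move=> sf fK mH HM H0.
have s1 := spectral_density1 R.
have fK' : ae_torus (fun x => f x <= `|K| + 1).
  by move: fK; apply: ae_torusS => x h; have := ler_norm K; lra.
have K0 : 0 < `|K| + 1 by rewrite ltr_wpDl.
have := vanishing_fcoef_L2N1 (bounded_inL2 s1 mH HM) H0.
move=> /(L2NP _ _ s1)[ih ah]; apply/L2NP => //.
have iH := bounded_inL2 sf mH HM.
split=> // e e0.
have [p [op pe]] := ah (e / (`|K| + 1)) (divr_gt0 e0 K0).
exists p; split=> //.
have [_ i1] := inL2B s1 ih (observed_inL2 s1 op).
have [_ i2] := inL2B sf iH (observed_inL2 sf op).
apply: (@le_lt_trans _ _ ((`|K| + 1) * wnorm (fun=> 1) (fun x => H x - p x))).
  rewrite /wnorm -tintegralZ//; apply: le_tintegral => //.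
    exact: tintegrableZ.
  by move: fK'; apply: ae_torusS => x fx; rewrite mulr1 mulrC ler_wpM2r//
    nsq_ge0.
by rewrite mulrC -ltr_pdivlMr.
Qed.

(** * Minimal densities and their reciprocals *)

Lemma measurable_inv (R : realType) : measurable_fun [set: R] (fun x : R =>
  x^-1).
Proof.
have -> : (fun x : R => x^-1) = fun x => if x == 0 then 0 else x^-1.
  by apply/funext => x; case: eqVneq => [->|//]; rewrite invr0.
apply: measurable_fun_if => //.
- by apply: measurable_fun_eqr.
- rewrite setTI; apply: open_continuous_measurable_fun.
    rewrite (_ : _ @^-1` _ = ~` [set 0]).
      by apply: closed_openC; exact: closed_eq.
    by apply/seteqP; split=> x /=; [move/negbT/eqP|move/eqP/negbTE].
  by move=> x; rewrite inE /= => /negbT x0; exact: inv_continuous.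
Qed.

Lemma measurable_inve (R : realType) :
  measurable_fun [set: R] (fun x : R => (x%:E)^-1%E).
Proof.
under eq_fun do rewrite inver.
apply: measurable_fun_if => //.
- by apply: measurable_fun_eqr.
- apply: (@measurable_funS _ _ _ _ setT) => //.
  by apply/measurable_EFinP; exact: measurable_inv.
Qed.

Lemma minimal_densityP (R : realType) (f : R -> R) : spectral_density f ->
  minimal_density f <->
  ae_torus (fun x => 0 < f x) /\ tintegrable (fun x => (f x)^-1).
Proof.
move=> [f0 jf]; have mf := tintegrable_measurable jf.
have mfV : measurable_fun (torus R) (fun x => (f x)^-1).
  by apply: (measurableT_comp (@measurable_inv R)).
have mfVe : measurable_fun (torus R) (fun x => ((f x)%:E)^-1%E).
  by apply: (measurableT_comp (@measurable_inve R)).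
have pos : ae_torus (fun x => 0 < f x) ->
    (\int[@lebesgue_measure R]_(x in torus R) ((f x)%:E)^-1 =
     \int[@lebesgue_measure R]_(x in torus R) ((f x)^-1)%:E)%E.
  move=> fpos.
  rewrite [LHS](@ae_eq_integral _ _ _ (@lebesgue_measure R) _
    (EFin \o (fun x => (f x)^-1)) _ (@measurable_torus R))//.
  - exact/measurable_EFinP.
  - move: fpos; apply: (@filterS _ _ (ae_filter R)).
    by move=> x h Dx /=; rewrite inver gt_eqF// h.
split=> [mn|[fpos ifV]]; last first.
  by rewrite /minimal_density pos// tintegralE// ltry.
have ie : (@lebesgue_measure R).-integrable (torus R) (fun x => ((f
  x)%:E)^-1%E).
  apply/integrableP; split=> //.
  rewrite [X in (X < _)%E](@ae_eq_integral _ _ _ (@lebesgue_measure R) _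
    (fun x => ((f x)%:E)^-1%E) _ (@measurable_torus R))//.
    exact: measurableT_comp.
  move: f0; apply: (@filterS _ _ (ae_filter R)).
  by move=> x h Dx /=; rewrite gee0_abs// inve_ge0 lee_fin h.
have fpos : ae_torus (fun x => 0 < f x).
  move: f0 (integrable_ae (@measurable_torus R) ie).
  apply: (@filterS2 _ _ (ae_filter R)).
  move=> x h + Dx => /(_ Dx); rewrite inver lt_neqAle (h Dx) andbT eq_sym.
  by case: eqP.
split=> //; apply: ge0_tintegrable => //.
  by move: fpos; apply: ae_torusS => x h; rewrite invr_ge0 ltW.
by rewrite -pos.
Qed.

(** * The matrix B_N and the dual bound *)

Lemma frequency_shift (R : realType) (k j : nat) (x : R) :
  j%:R * x + (- k%:Z)%:~R * x = - ((k%:R - j%:R) * x).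
Proof. by rewrite mulrNz -pmulrn; ring. Qed.

Lemma ctintegrable_realM (R : realType) (l : seq (int * R[i])) (g : R -> R) :
  tintegrable g -> ctintegrable (fun x => trigp l x * (g x)%:C).
Proof.
move=> ig; have [M lM] := bounded_trigp l.
under eq_fun do rewrite mulrC.
apply: (@ctintegrableM_bounded _ _ _ M); last exact: ae_torusW.
  by split=> //=; exact: tintegrable_cst.
exact: cmeasurable_trigp.
Qed.

(** This is the origin of [B_mx]: prescribing the coefficients of C / f on 0..N is a linear system
    with that matrix. *)
Lemma fcoef_trig_polyV (R : realType) (N : nat) (c : 'cV[R[i]]_N.+1)
    (f : R -> R) (k : 'I_N.+1) : tintegrable (fun x => (f x)^-1) ->
  fcoef (fun x => trig_poly c x * ((f x)^-1)%:C) k%:Z =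
  (2 * pi)%:C * (B_mx N f *m c) k 0.
Proof.
move=> ifV; have pi0 := pi_gt0 R.
have ifC : ctintegrable (fun x => ((f x)^-1)%:C : R[i]).
  by split=> //=; exact: tintegrable_cst.
have iE (j : 'I_N.+1) : ctintegrable (fun x =>
    c j 0 * (((f x)^-1)%:C * expi (- ((k%:R - j%:R) * x)))).
  apply: ctintegrableZ; under eq_fun do rewrite -mulNr.
  exact: ctintegrableM_expi.
rewrite /fcoef; transitivity (cintegral (fun x =>
    \sum_(j < N.+1) c j 0 * (((f x)^-1)%:C * expi (- ((k%:R - j%:R) * x))))).
  congr cintegral; apply/funext => x; rewrite /trig_poly !mulr_suml.
  apply: eq_bigr => j _; rewrite -frequency_shift expiD; ring.
rewrite cintegral_sum// mxE mulr_sumr; apply: eq_bigr => j _.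
rewrite mxE cintegralZ; last first.
  by under eq_fun do rewrite -mulNr; exact: ctintegrableM_expi.
set E := cintegral _.
have pi2 : ((2 * pi)^-1)%:C * (2 * pi)%:C = 1 :> R[i].
  apply: complex_eq; rewrite !reim /= ?mul0r ?mulr0 ?subr0 ?addr0//.
  by rewrite mulVf// gt_eqF// mulr_gt0.
transitivity (((2 * pi)^-1)%:C * (2 * pi)%:C * (E * c j 0)); last by ring.
by rewrite pi2 mul1r mulrC.
Qed.

(** A polynomial with frequencies 0..N meets only the coefficients of [g] there, so the pairing sees
    [g] through [a] alone. *)
Lemma tintegral_pairing (R : realType) (N : nat) (a c : 'cV[R[i]]_N.+1)
    (g : R -> R[i]) : ctintegrable g ->
  (forall k : 'I_N.+1, fcoef g k%:Z = (2 * pi)%:C * a k 0) ->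
  tintegrable (fun x => complex.Re (g x * conjc (trig_poly c x))) /\
  tintegral (fun x => complex.Re (g x * conjc (trig_poly c x))) =
  2 * pi * complex.Re (inner a c).
Proof.
move=> ig ga.
have E : (fun x => g x * conjc (trig_poly c x)) = fun x =>
    \sum_(k < N.+1) conjc (c k 0) * (g x * expi ((- k%:Z)%:~R * x)).
  apply/funext => x.
  transitivity (g x * \sum_(k < N.+1) conjc (c k 0) * conjc (expi (k%:R * x))).
    rewrite /trig_poly (rmorph_sum (@conjc R)); congr (_ * _).
    by apply: eq_bigr => k _; exact: rmorphM.
  rewrite mulr_sumr; apply: eq_bigr => k _.
  by rewrite conj_expi mulrNz mulNr -pmulrn mulrCA.
have iE (k : 'I_N.+1) : ctintegrable (fun x =>
    conjc (c k 0) * (g x * expi ((- k%:Z)%:~R * x))).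
  by apply: ctintegrableZ; exact: ctintegrableM_expi.
have iS : ctintegrable (fun x => g x * conjc (trig_poly c x)).
  by rewrite E; exact: ctintegrable_sum.
split; first by case: iS.
have : cintegral (fun x => g x * conjc (trig_poly c x)) =
    (2 * pi)%:C * inner a c.
  rewrite E cintegral_sum// /inner mulr_sumr; apply: eq_bigr => k _.
  rewrite cintegralZ; last exact: ctintegrableM_expi.
  by rewrite -/(fcoef g k%:Z) ga mulrC mulrA.
rewrite cintegralE => /(congr1 (@complex.Re R)); rewrite [LHS]/= => ->.
by rewrite reim /= mul0r subr0.
Qed.

Lemma ae_inv_spectral (R : realType) (f : R -> R) :
  ae_torus (fun x => 0 < f x) -> tintegrable (fun x => (f x)^-1) ->
  spectral_density (fun x => (f x)^-1).
Proof.
move=> fpos ifV; split=> //; move: fpos; apply: ae_torusS => x h.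
by rewrite invr_ge0 ltW.
Qed.

(* Integrate |g|^2 f - 2 Re (g conj C) + |C|^2 / f = |f g - C|^2 / f >= 0, where
   C is the trigonometric polynomial with coefficients c. *)
Lemma wnorm_dual_bound (R : realType) (N : nat) (f : R -> R)
    (a c : 'cV[R[i]]_N.+1) (g : R -> R[i]) :
  spectral_density f -> minimal_density f -> inL2 f g -> ctintegrable g ->
  (forall k : 'I_N.+1, fcoef g k%:Z = (2 * pi)%:C * a k 0) ->
  2 * (2 * pi * complex.Re (inner a c)) -
    wnorm (fun x => (f x)^-1) (trig_poly c) <= wnorm f g.
Proof.
move=> sf /(minimal_densityP sf)[fpos ifV] [_ ig] cg ga.
have [ip Ep] := tintegral_pairing c cg ga.
have [_ iC] := trig_poly_inL2 c (ae_inv_spectral fpos ifV).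
rewrite -Ep /wnorm -tintegralZ// -tintegralB//; last exact: tintegrableZ.
apply: le_tintegral => //.
  by apply: tintegrableB => //; exact: tintegrableZ.
move: fpos; apply: ae_torusS => x fx; rewrite -subr_ge0.
have -> : nsq (g x) * f x - (2 * complex.Re (g x * conjc (trig_poly c x)) -
    nsq (trig_poly c x) * (f x)^-1) =
    nsq ((f x)%:C * g x - trig_poly c x) * (f x)^-1.
  by rewrite /nsq !reim /=; field; rewrite gt_eqF.
by rewrite mulr_ge0 ?nsq_ge0// invr_ge0 ltW.
Qed.

(** If B c = 0, pairing C / f with C shows that the integral of |C|^2 / f is 0, so C vanishes almost
    everywhere and its coefficients [c] are 0. *)
Lemma B_mx_unit (R : realType) (N : nat) (f : R -> R) :
  spectral_density f -> minimal_density f -> B_mx N f \in unitmx.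
Proof.
move=> sf /(minimal_densityP sf)[fpos ifV]; have pi0 := pi_gt0 R.
(* [det0P] yields a row vector killed from the left; passing to the transpose first makes it a
   column in the kernel of [B_mx]. *)
rewrite -unitmx_tr unitmxE unitfE; apply/negP => /det0P[v v0].
move=> /(congr1 trmx); rewrite trmx_mul trmxK trmx0; set c := v^T => Bc.
have C0 (k : 'I_N.+1) : fcoef (fun x => trig_poly c x * ((f x)^-1)%:C) k%:Z =
    (2 * pi)%:C * (0 : 'cV[R[i]]_N.+1) k 0.
  by rewrite fcoef_trig_polyV// Bc.
have iC : ctintegrable (fun x => trig_poly c x * ((f x)^-1)%:C).
  by rewrite trig_polyE; exact: ctintegrable_realM.
have [ip] := tintegral_pairing c iC C0.
rewrite (_ : inner _ _ = 0); last first.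
  by rewrite /inner big1// => k _; rewrite mxE mul0r.
rewrite mulr0 => ip0.
have pE x : complex.Re (trig_poly c x * ((f x)^-1)%:C * conjc (trig_poly c x)) =
    nsq (trig_poly c x) * (f x)^-1.
  by rewrite /nsq !reim /=; ring.
have C_ae : ae_torus (fun x => trig_poly c x = 0).
  have := tintegral_eq0 ip _ ip0.
  have h : ae_torus (fun x => 0 <=
      complex.Re (trig_poly c x * ((f x)^-1)%:C * conjc (trig_poly c x))).
    move: fpos; apply: ae_torusS => x fx.
    by rewrite pE mulr_ge0 ?nsq_ge0// invr_ge0 ltW.
  move=> /(_ h); move: fpos; apply: ae_torusS2 => x fx.
  rewrite pE => /eqP; rewrite mulf_eq0 invr_eq0 (gt_eqF fx) orbF => /eqP.
  exact: nsq_eq0.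
suff c0 : c = 0 by move: v0; rewrite -[v]trmxK -/c c0 trmx0 eqxx.
apply/colP => k; rewrite [RHS]mxE.
have : fcoef (trig_poly c) k%:Z = 0.
  rewrite /fcoef -[RHS](cintegral0 R) !cintegralE.
  have [i1 i2] : ctintegrable (fun x => trig_poly c x * expi ((- k%:Z)%:~R *
    x)).
    by apply: ctintegrableM_expi; rewrite trig_polyE; exact: ctintegrable_trigp.
  by congr (_ +i* _); apply: eq_tintegral => //;
    (try exact: tintegrable_cst); move: C_ae; apply: ae_torusS => x ->;
    rewrite mul0r.
rewrite fcoef_trig_poly => /eqP; rewrite mulf_eq0 => /orP[|/eqP//].
by move=> /eqP/(congr1 (@complex.Re R))/= /eqP; rewrite mulf_eq0 !gt_eqF.
Qed.

Definition opt_coef (R : realType) (N : nat) (a : 'cV[R[i]]_N.+1) (f : R -> R) :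
    'cV[R[i]]_N.+1 :=
  invmx (B_mx N f) *m a.

Lemma fcoef_C_polyV (R : realType) (N : nat) (a : 'cV[R[i]]_N.+1) (f : R -> R)
    (k : 'I_N.+1) : spectral_density f -> minimal_density f ->
  fcoef (fun x => C_poly a f x * ((f x)^-1)%:C) k%:Z = (2 * pi)%:C * a k 0.
Proof.
move=> sf mn; have [_ ifV] := (minimal_densityP sf).1 mn.
by rewrite /C_poly fcoef_trig_polyV// mulKVmx//; exact: B_mx_unit.
Qed.

Lemma ctintegrable_C_polyV (R : realType) (N : nat) (a : 'cV[R[i]]_N.+1)
    (f : R -> R) : spectral_density f -> minimal_density f ->
  ctintegrable (fun x => C_poly a f x * ((f x)^-1)%:C).
Proof.
move=> sf mn; have [_ ifV] := (minimal_densityP sf).1 mn.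
by rewrite /C_poly trig_polyE; exact: ctintegrable_realM.
Qed.

(** Both norms are the integral of |C|^2 / f, that is the pairing of C / f with C, and C / f has the
    coefficients [a] on 0..N. *)
Lemma C_polyV_norm (R : realType) (N : nat) (a : 'cV[R[i]]_N.+1)
    (f : R -> R) : spectral_density f -> minimal_density f ->
  [/\ inL2 f (fun x => C_poly a f x * ((f x)^-1)%:C),
      wnorm f (fun x => C_poly a f x * ((f x)^-1)%:C) =
        2 * pi * complex.Re (inner a (opt_coef a f)) &
      wnorm (fun x => (f x)^-1) (C_poly a f) =
        2 * pi * complex.Re (inner a (opt_coef a f))].
Proof.
move=> sf mn; have [fpos ifV] := (minimal_densityP sf).1 mn.
have iC := ctintegrable_C_polyV a sf mn.
have [ip Ep] := tintegral_pairing (opt_coef a f) iC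
  (fun k => fcoef_C_polyV a k sf mn).
have [_ iCV] := trig_poly_inL2 (opt_coef a f) (ae_inv_spectral fpos ifV).
have i2 : tintegrable (fun x => nsq (C_poly a f x * ((f x)^-1)%:C) * f x).
  apply: le_tintegrable iCV.
    by apply: measurable_nsqM => //; exact: ctintegrable_measurable.
  move: fpos; apply: ae_torusS => x fx.
  rewrite ger0_norm; last by rewrite mulr_ge0 ?nsq_ge0// ltW.
  by rewrite nsqM nsq_real -mulrA expr2 -mulrA mulVf ?mulr1// gt_eqF.
split; first by split=> //; exact: ctintegrable_measurable.
- rewrite -Ep; apply: eq_tintegral => //; move: fpos; apply: ae_torusS => x fx.
  by rewrite /C_poly -/(opt_coef a f) /nsq !reim /=; field; rewrite gt_eqF.
- rewrite -Ep; apply: eq_tintegral => //; move: fpos; apply: ae_torusS => x fx.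
  by rewrite /C_poly -/(opt_coef a f) /nsq !reim /=; field; rewrite gt_eqF.
Qed.

(** * Estimation error and the saddle point inequality *)

Lemma Re_inner_conj (R : realType) (N : nat) (x y : 'cV[R[i]]_N.+1) :
  complex.Re (inner x y) = complex.Re (inner y x).
Proof.
have -> : inner x y = conjc (inner y x).
  rewrite /inner (rmorph_sum (@conjc R)); apply: eq_bigr => k _.
  by apply: complex_eq; rewrite !reim; ring.
exact: ReJ.
Qed.

Lemma inner_le_Re (R : realType) (N : nat) (a x y : 'cV[R[i]]_N.+1) :
  inner x a <= inner y a ->
  complex.Re (inner a x) <= complex.Re (inner a y).
Proof.
by rewrite lecE => /andP[_]; rewrite (Re_inner_conj a x) (Re_inner_conj a y).
Qed.

Lemma ess_bounded_nsq (R : realType) (h : R -> R[i]) : ess_bounded h ->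
  exists M, ae_torus (fun x => nsq (h x) <= M).
Proof.
move=> [M hM]; exists (M ^+ 2); move: hM; apply: ae_torusS => x hx.
have m0 : 0 <= modulus (h x) by case: (h x) => p q; exact: sqrtr_ge0.
by rewrite -sqr_modulus !expr2 ler_pM.
Qed.

Lemma ess_bounded_real (R : realType) (f : R -> R) :
  ess_bounded (fun x => (f x)%:C) -> exists M, ae_torus (fun x => f x <= M).
Proof.
move=> [M hM]; exists M; move: hM; apply: ae_torusS => x.
apply: le_trans; rewrite /modulus /= expr0n addr0 sqrtr_sqr.
exact: ler_norm.
Qed.

Lemma DeltaE (R : realType) (N : nat) (a : 'cV[R[i]]_N.+1) (f : R -> R)
    (h : R -> R[i]) : spectral_density f -> inL2 f h ->
  Delta a h f = ((2 * pi)^-1 * wnorm f (fun x => trig_poly a x - h x))%:E.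
Proof.
move=> sf ih; rewrite /Delta sqnormL2E -?EFinM//.
by apply: inL2B => //; exact: trig_poly_inL2.
Qed.

(** The difference of the target polynomial and [p] has the coefficients [a] on 0..N. In the dual
    bound at [opt_coef a f] the quadratic term is half of the linear one, which leaves exactly this
    value. *)
Lemma wnorm_observed_lower_bound (R : realType) (N : nat)
    (a : 'cV[R[i]]_N.+1) (f : R -> R) (p : R -> R[i]) :
  spectral_density f -> minimal_density f -> observed_poly N p ->
  2 * pi * complex.Re (inner a (opt_coef a f)) <=
  wnorm f (fun x => trig_poly a x - p x).
Proof.
move=> sf mn op.
have iA := trig_poly_inL2 a (spectral_density1 R).
have ip := observed_inL2 (spectral_density1 R) op.
have := @wnorm_dual_bound _ _ f a (opt_coef a f) (fun x => trig_poly a x - p x)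
  sf mn.
have [_ _ ->] := C_polyV_norm a sf mn.
move=> /(_ _ _ _)/(le_trans _); apply.
- by lra.
- by apply: inL2B => //; [exact: trig_poly_inL2|exact: observed_inL2 op].
- by apply: inL2_ctintegrable; exact: (inL2B (spectral_density1 R)).
- move=> k; rewrite fcoefB; [|exact: inL2_ctintegrable..].
  rewrite fcoef_trig_poly (fcoef_observed op) ?subr0//.
  by rewrite lez_nat -ltnS ltn_ord.
Qed.

Lemma h_char_sub (R : realType) (N : nat) (a : 'cV[R[i]]_N.+1) (f : R -> R) :
  (fun x => trig_poly a x - h_char a f x) =
  fun x => C_poly a f x * ((f x)^-1)%:C.
Proof. by apply/funext => x; rewrite /h_char subKr. Qed.

Lemma D_band_convex (R : realType) (v u f g : R -> R) (P1 t : R) :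
  0 <= t <= 1 -> D_band v u P1 f -> D_band v u P1 g ->
  D_band v u P1 (fun x => (1 - t) * f x + t * g x).
Proof.
move=> /andP[t0 t1] [[f0 jf] [fb fP]] [[g0 jg] [gb gP]].
have t1' : 0 <= 1 - t by lra.
split; last split.
- split.
    by move: f0 g0; apply: ae_torusS2 => x f0 g0; rewrite addr_ge0// mulr_ge0.
  by apply: tintegrableD; apply: tintegrableZ.
- move: fb gb; apply: ae_torusS2 => x /andP[a1 a2] /andP[b1 b2].
  by apply/andP; split; nra.
- rewrite -/(tintegral _) tintegralD ?tintegralZ//; try exact: tintegrableZ.
  have := ler_wpM2l t1' fP; have := ler_wpM2l t0 gP.
  by rewrite -!/(tintegral _) !mulrDr => h1 h2;
    rewrite mulrCA [_^-1 * (t * _)]mulrCA; lra.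
Qed.

Lemma minimal_density_ge (R : realType) (f g : R -> R) (c : R) : 0 < c ->
  spectral_density f -> minimal_density f -> spectral_density g ->
  ae_torus (fun x => c * f x <= g x) -> minimal_density g.
Proof.
move=> c0 sf mn sg fg; have [fpos ifV] := (minimal_densityP sf).1 mn.
have gpos : ae_torus (fun x => 0 < g x).
  by move: fpos fg; apply: ae_torusS2 => x fx; apply: lt_le_trans; rewrite
    mulr_gt0.
apply/(minimal_densityP sg); split=> //.
apply: (le_tintegrable _ _ (tintegrableZ c^-1 ifV)).
  case: sg => _ /tintegrable_measurable mg.
  by apply: (measurableT_comp (@measurable_inv R)).
move: fpos fg gpos; apply: ae_torusS3 => x fx h gx.
have gV : 0 < (g x)^-1 by rewrite invr_gt0.
by rewrite ger0_norm ?(ltW gV)// -invfM lef_pV2// posrE mulr_gt0.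
Qed.

(** The dual bound is applied to the extremal function of [f]. Its squared norm is at most X = 2 pi
    Re <a, c> by hypothesis, so 2 X minus the dual norm is at most X. *)
Lemma dual_norm_ge (R : realType) (N : nat) (a c : 'cV[R[i]]_N.+1)
    (f : R -> R) : spectral_density f -> minimal_density f ->
  complex.Re (inner a (opt_coef a f)) <= complex.Re (inner a c) ->
  2 * pi * complex.Re (inner a c) <= wnorm (fun x => (f x)^-1) (trig_poly c).
Proof.
move=> sf mn le_c; have [ig Eg _] := C_polyV_norm a sf mn.
have := wnorm_dual_bound c sf mn ig (ctintegrable_C_polyV a sf mn)
  (fun k => fcoef_C_polyV a k sf mn).
have pi2 : 0 <= 2 * pi :> R by rewrite mulr_ge0// pi_ge0.
rewrite Eg => /le_trans /(_ (ler_wpM2l pi2 le_c)).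
by rewrite lerBlDr mulr_natl mulr2n lerD2l.
Qed.

(* Optimality of f0 along the segment f_t = (1 - t) f0 + t f gives, through the
   dual bound at c = opt_coef a f0, that the integral of |C0|^2 f / (f0 f_t) is
   at most that of |C0|^2 / f0; then let t tend to 0. *)
Lemma saddle_inequality (R : realType) (N : nat) (a : 'cV[R[i]]_N.+1)
    (v u f0 f : R -> R) (P1 : R) :
  solves_extremum a (D_band v u P1) f0 -> D_band v u P1 f ->
  let g0 := fun x => C_poly a f0 x * ((f0 x)^-1)%:C in
  inL2 f g0 /\ wnorm f g0 <= wnorm f0 g0.
Proof.
move=> [Df0 [mn0 opt]] Df g0.
have [sf0 _] := Df0; have [sf _] := Df.
have [f0pos if0V] := (minimal_densityP sf0).1 mn0.
have [ig0 Eg0 EC0] := C_polyV_norm a sf0 mn0.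
rewrite -/g0 in ig0 Eg0; set K := 2 * pi * _ in Eg0 EC0.
(* Starting at 1/2 keeps t n < 1, so that the factor 1 - t n in front of [f0] is positive and [ft n]
   is minimal. *)
pose t n : R := n.+2%:R^-1.
have t01 n : 0 < t n < 1 by rewrite invr_gt0 ltr0Sn/= invf_lt1 ?ltr1n ?ltr0Sn.
pose ft n x := (1 - t n) * f0 x + t n * f x.
have Dft n : D_band v u P1 (ft n).
  by apply: D_band_convex => //; have /andP[? ?] := t01 n; apply/andP; split;
    exact: ltW.
have sft n : spectral_density (ft n) by case: (Dft n).
have f_ge0 : ae_torus (fun x => 0 <= f x) by case: sf.
have mnft n : minimal_density (ft n).
  have /andP[t0 t1] := t01 n.
  apply: (@minimal_density_ge _ f0 _ (1 - t n)) => //; first by lra.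
  by move: f_ge0; apply: ae_torusS => x fx; rewrite /ft lerDl mulr_ge0// ltW.
have [_ iC0] : inL2 (fun x => (f0 x)^-1) (C_poly a f0).
  exact: (trig_poly_inL2 _ (ae_inv_spectral f0pos if0V)).
have iCt n : tintegrable (fun x => nsq (C_poly a f0 x) * (ft n x)^-1).
  have [p q] := (minimal_densityP (sft n)).1 (mnft n).
  by case: (trig_poly_inL2 (opt_coef a f0) (ae_inv_spectral p q)).
have KCt n : K <= wnorm (fun x => (ft n x)^-1) (C_poly a f0).
  apply: (@dual_norm_ge _ _ _ (opt_coef a f0) _ (sft n) (mnft n)).
  exact: inner_le_Re (opt _ (Dft n) (mnft n)).
(* Since 1 / f0 - (1 - t) / f_t = t f / (f0 f_t), this is |C0|^2 f / (f0 f_t), which is nonnegative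
   and tends to |C0 / f0|^2 f. The form as a difference shows its integrability and bounds its
   integral. *)
pose g_ n x := (t n)^-1 * (nsq (C_poly a f0 x) * (f0 x)^-1 -
  (1 - t n) * (nsq (C_poly a f0 x) * (ft n x)^-1)).
have g_E n x : 0 < f0 x -> 0 <= f x ->
    g_ n x = nsq (C_poly a f0 x) * f x * ((f0 x)^-1 * (ft n x)^-1).
  move=> f0x fx; have /andP[t0 t1] := t01 n.
  have ftx : 0 < ft n x.
    by rewrite /ft ltr_wpDr ?mulr_ge0 ?mulr_gt0 ?subr_gt0// ltW.
  rewrite /g_; move: (lt0r_neq0 ftx); rewrite /ft => ftn.
  by field; rewrite ftn !gt_eqF.
have ig n : tintegrable (g_ n).
  by apply: tintegrableZ; apply: tintegrableB => //; apply: tintegrableZ.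
have mg0 : cmeasurable g0 by case: ig0.
have [] := @tintegral_fatou R g_ (fun x => nsq (g0 x) * f x) (fun=> K) K ig.
- move=> n; move: f0pos f_ge0; apply: ae_torusS2 => x f0x fx.
  have /andP[t0 t1] := t01 n.
  rewrite g_E// !mulr_ge0 ?nsq_ge0 ?invr_ge0 ?addr_ge0 ?mulr_ge0 ?subr_ge0//;
    exact: ltW.
- exact: measurable_nsqM.
- move: f0pos f_ge0; apply: ae_torusS2 => x f0x fx.
  under eq_fun do rewrite g_E//.
  rewrite nsqM nsq_real expr2 -mulrA [_ * f x]mulrC mulrA.
  apply: cvgM; first exact: cvg_cst.
  apply: cvgM; first exact: cvg_cst.
  apply: cvgV; first by rewrite gt_eqF.
  have ct : t n @[n --> \oo] --> (0 : R).
    by have := @cvg_harmonic R; rewrite -(cvg_shiftS (@harmonic R)).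
  rewrite -[X in _ --> X](_ : (1 - 0) * f0 x + 0 * f x = _); last first.
    by rewrite subr0 mul1r mul0r addr0.
  by apply: cvgD; apply: cvgM; [apply: cvgB => //|..]; try exact: cvg_cst.
(* The integral of |C0|^2 / f_t is at least [K] by [KCt], so the integral of [g_ n] is at most (K -
   (1 - t) K) / t = K. *)
- move=> n; have /andP[t0 t1] := t01 n.
  rewrite tintegralZ; last by apply: tintegrableB => //; apply: tintegrableZ.
  rewrite tintegralB//; last exact: tintegrableZ.
  rewrite tintegralZ// ler_pdivrMl//.
  rewrite (_ : tintegral (fun x => nsq (C_poly a f0 x) / f0 x) = K)//.
  have : (1 - t n) * K <= (1 - t n) *
      tintegral (fun x => nsq (C_poly a f0 x) * (ft n x)^-1).
    by apply: ler_wpM2l; [rewrite subr_ge0 ltW|exact: KCt].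
  by rewrite mulrBl mul1r; lra.
- exact: cvg_cst.
move=> i1 i2; split=> //.
by rewrite Eg0.
Qed.

Theorem theorem7p7 (R : realType) (N : nat) (a : 'cV[R[i]]_N.+1) (P1 : R)
    (v u f0 : R -> R) (alpha1 : R)
    (hP1 : 0 < P1)
    (hv : spectral_density v) (hu : spectral_density u)
    (hvb : ess_bounded (fun x => (v x)%:C))
    (hub : ess_bounded (fun x => (u x)%:C))
    (hf0 : D_band v u P1 f0)
    (hf0inv : minimal_density f0)
    (hbounded : ess_bounded (h_char a f0))
    (halpha1 : 0 < alpha1)
    (hform : ae_torus (fun x =>
       f0 x = Num.max (v x) (Num.min (u x) (alpha1 * modulus (C_poly a f0 x)))))
    (hmax : solves_extremum a (D_band v u P1) f0) :
  least_favourable a (D_band v u P1) f0 /\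
  optimal_char a f0 (h_char a f0) /\
  minimax_robust a (D_band v u P1) (h_char a f0).
Proof.
have [sf0 _] := hf0.
have pi2V : 0 < (2 * pi)^-1 :> R by rewrite invr_gt0 mulr_gt0// pi_gt0.
have [M hM] := ess_bounded_nsq hbounded.
have [Ku hKu] := ess_bounded_real hub.
have iC0 := ctintegrable_C_polyV a sf0 hf0inv.
have iA : ctintegrable (trig_poly a) by rewrite trig_polyE; exact:
  ctintegrable_trigp.
have mh0 : cmeasurable (h_char a f0).
  by apply: cmeasurableB; exact: ctintegrable_measurable.
have h00 (k : 'I_N.+1) : fcoef (h_char a f0) k%:Z = 0.
  by rewrite fcoefB// fcoef_trig_poly fcoef_C_polyV// subrr.
have Lh0 f : D_band v u P1 f -> L2N N f (h_char a f0).
  move=> [sf [fvu _]]; apply: (@bounded_vanishing_L2N _ _ _ _ M Ku) => //.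
  by move: fvu hKu; apply: ae_torusS2 => x /andP[_]; exact: le_trans.
have ih0 f (Df : D_band v u P1 f) : inL2 f (h_char a f0).
  by have [sf _] := Df; case: ((L2NP _ _ sf).1 (Lh0 f Df)).
have opt0 : optimal_char a f0 (h_char a f0).
  split=> [|g Lg]; first exact: Lh0.
  have [ig _] := (L2NP _ _ sf0).1 Lg.
  rewrite !DeltaE//; last exact: ih0.
  rewrite lee_fin ler_pM2l// h_char_sub.
  have [_ -> _] := C_polyV_norm a sf0 hf0inv.
  apply: L2N_lower_bound Lg => //; first exact: trig_poly_inL2.
  by move=> p; exact: wnorm_observed_lower_bound.
have saddle f : D_band v u P1 f ->
    (Delta a (h_char a f0) f <= Delta a (h_char a f0) f0)%E.
  move=> Df; have [sf _] := Df.
  rewrite !DeltaE//; [|exact: ih0..].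
  rewrite lee_fin ler_pM2l// !h_char_sub.
  by have [] := saddle_inequality hmax Df.
split; [|split=> //].
(* The minimizer for [f] does at least as well under [f] as [h_char a f0], which is admissible for
   [f]; the saddle inequality then compares with [f0]. *)
- split=> //; exists (h_char a f0); split=> // f Df.
  have [sf _] := Df.
  have [h [Lh hmin]] := projection N sf (trig_poly_inL2 a sf).
  have hopt : optimal_char a f h.
    split=> // g Lg; have [ih _] := (L2NP _ _ sf).1 Lh.
    have [ig _] := (L2NP _ _ sf).1 Lg.
    by rewrite !DeltaE// lee_fin ler_pM2l// hmin.
  exists h; split=> //; apply: le_trans (saddle f Df).
  by case: hopt => _; apply; exact: Lh0.
(* The saddle inequality bounds the supremum for [h_char a f0] by its error at [f0]; by optimality
   there, this is at most the error of [h] at [f0], one of the values under the other supremum. *)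
- split=> [f Df|h Hh]; first exact: Lh0.
  apply: (@le_trans _ _ (Delta a (h_char a f0) f0)).
    by apply: ge_ereal_sup => _ [f Df <-]; exact: saddle.
  apply: (@le_trans _ _ (Delta a h f0)).
    by case: opt0 => _; apply; exact: Hh.
  by apply: ereal_sup_ubound; exists f0.
Qed.
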